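(* Let $L\subset k[x,y]$ be a lex-segment ideal (with $\dim_k k[x,y]/L<\infty$ and radical $(x,y)$), and let $j,u$ be integers. With the notation of the context, under the identification of $V(L)$ with the affine space $\mathbf A^n$, $n=\#\mathcal S(L)$, the variety $V(L,j,\ge u)$ is defined by the condition $$\operatorname{rank} M(p)_j\le \beta_{0,j}(L)-u,$$ where $M(p)_j$ is a matrix of distinct variables (distinct coordinates of $\mathbf A^n$) of size $\beta_{0,j}(L)\times\beta_{1,j}(L)$. In particular: (1) $V(L,j,\ge u)$ is irreducible. It coincides with the closure of $V(L,j,u)$ provided $V(L,j,u)$ is not empty, that is, provided $\beta_{0,j}(L)-\beta_{1,j}(L)\le u\le\beta_{0,j}(L)$. (2) If $\beta_{0,j}(L)-\beta_{1,j}(L)\le u\le\beta_{0,j}(L)$, then the codimension of $V(L,j,\ge u)$ is $(\beta_{1,j}(L)-\beta_{0,j}(L)+u)\,u$.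
   Context: $k$ is a field, $R=k[x,y]$ with the lexicographic term order with $x>y$. $\mathrm{Lt}(I)$ is the ideal generated by the leading monomials of the nonzero elements of $I$. For a monomial ideal $E$ with radical $(x,y)$ (so $\dim_kR/E<\infty$) put $t=\min\{j:x^j\in E\}$; $m_i=\min\{j:x^{t-i}y^j\in E\}$ for $0\le i\le t$ (so $0=m_0<m_1\le\dots\le m_t$); $d_i=m_i-m_{i-1}$ for $1\le i\le t$; $u_{ij}=m_j-m_{i-1}+i-j$ for $1\le i\le t+1$, $1\le j\le t$; $\mathcal S(E)=\{(i,j):1\le j<i\le t+1,\ 0\le u_{ij}<d_j\}$. The ideal $E$ is a lex-segment ideal if and only if $d_i>0$ for all $i=1,\dots,t$. $M_0(E)$ is the $(t+1)\times t$ matrix with $(i,i)$-entry $y^{d_i}$, $(i+1,i)$-entry $-x$ ($1\le i\le t$), and $0$ elsewhere. For $p=(p_{ij})_{(i,j)\in\mathcal S(E)}\in\mathbf A^n$, $n=\#\mathcal S(E)$, let $M(p)=M_0(E)+N$, where $N$ has $(i,j)$-entry $p_{ij}y^{u_{ij}}$ if $(i,j)\in\mathcal S(E)$ and $0$ otherwise. $V(E)$ is the set of homogeneous ideals $I$ of $R$ with $\mathrm{Lt}(I)=E$. It is identified with $\mathbf A^n$ via the bijection sending $p$ to the ideal $I_p$ of $t\times t$ minors of $M(p)$. For a homogeneous ideal $I$, $\beta_{i,j}(I)=\dim_k\mathrm{Tor}_i^R(I,k)_j$ is the $(i,j)$-th Betti number; in particular $\beta_{0,j}(I)$ is the number of minimal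 generators of $I$ of degree $j$. For integers $j,u$ put $V(E,j,u)=\{I\in V(E):\beta_{0,j}(I)=u\}$ and $V(E,j,\ge u)=\{I\in V(E):\beta_{0,j}(I)\ge u\}$. Let $a_i=t+1-i+m_{i-1}$ for $1\le i\le t+1$ and $b_i=a_{i+1}+1$ for $1\le i\le t$, so that $I_p$ has a free resolution $0\to\bigoplus_{i=1}^tR(-b_i)\xrightarrow{M(p)}\bigoplus_{i=1}^{t+1}R(-a_i)\to I_p\to 0$. Let $w_j=\{i:a_i=j\}$, $v_j=\{i:b_i=j\}$. $M(p)_j$ is the submatrix of $M(p)$ with row indices $w_j$ and column indices $v_j$. Codimension is taken in $V(L)=\mathbf A^n$.
   Formalization: Non-emptiness of V(L,j,u) and the codimension formula in (2) also require u ≥ 0 (for L=(x,y)^2, j=3, u=-1 the claim fails: V(L,j,u) is empty, the formula gives -1); irreducibility of V(L,j,≥u) is asserted for u ≤ β_{0,j}(L), since it is empty otherwise. *)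

(* Defs.v *)
From Stdlib Require Import ClassicalEpsilon.
From HB Require Import structures.
From mathcomp Require Import all_boot all_order all_algebra.
From mathcomp Require Import fraction generic_quotient ring_quotient.
From mathcomp Require Import mpoly ring.

Set Implicit Arguments.
Unset Strict Implicit.
Unset Printing Implicit Defensive.

Import Order.TTheory GRing.Theory Num.Theory.
Local Open Scope ring_scope.

(* The least natural number satisfying [P] (unspecified if there is none). *)
Definition least (P : nat -> Prop) : nat :=
  epsilon (inhabits 0%N) (fun n => P n /\ forall n', P n' -> (n <= n')%N).

Definition infinite_field (k : fieldType) : Prop :=
  forall s : seq k, exists x : k, x \notin s.

(** * Ideals of a commutative ring, as predicates *)

Definition is_ideal (R : comNzRingType) (I : R -> Prop) : Prop :=
  [/\ I 0, (forall f g, I f -> I g -> I (f + g)) & forall h f, I f -> I (h * f)].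

Definition ideal_gen (R : comNzRingType) (A : R -> Prop) : R -> Prop :=
  fun f => forall I, is_ideal I -> (forall g, A g -> I g) -> I f.

(** * K[x,y], with the lexicographic order such that x > y *)

Notation xvar K := ('X_(@ord0 1) : {mpoly K[2]}).
Notation yvar K := ('X_(@ord_max 1) : {mpoly K[2]}).

Definition lex_lt (m1 m2 : 'X_{1..2}) : bool :=
  (m1 ord0 < m2 ord0)%N ||
  ((m1 ord0 == m2 ord0) && (m1 ord_max < m2 ord_max)%N).

Definition is_lead_monomial (K : fieldType) (f : {mpoly K[2]}) (m : 'X_{1..2}) :=
  m \in msupp f /\ forall m', m' \in msupp f -> m' = m \/ lex_lt m' m.

Definition Lt (K : fieldType) (I : {mpoly K[2]} -> Prop) : {mpoly K[2]} -> Prop :=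
  ideal_gen (fun g => exists f m, [/\ I f, f != 0, is_lead_monomial f m & g = 'X_[m]]).

(* Degrees are integers, so that shifts of degrees are harmless; [0] is
   homogeneous of every degree, and is the only form of negative degree. *)
Definition is_form (K : fieldType) (d : int) (f : {mpoly K[2]}) : bool :=
  all (fun m => (mdeg m)%:Z == d) (msupp f).

Definition homogeneous_ideal (K : fieldType) (I : {mpoly K[2]} -> Prop) : Prop :=
  is_ideal I /\
  forall f, I f -> ideal_gen (fun g => I g /\ exists d, is_form d g) f.

Definition monomial_ideal (K : fieldType) (I : {mpoly K[2]} -> Prop) : Prop :=
  is_ideal I /\
  forall f, I f -> ideal_gen (fun g => I g /\ exists m, g = 'X_[m]) f.

Definition lex_segment_ideal (K : fieldType) (I : {mpoly K[2]} -> Prop) : Prop :=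
  monomial_ideal I /\
  forall m m', mdeg m = mdeg m' -> lex_lt m m' ->
    I 'X_[m] -> I 'X_[m'].

Definition radical (K : fieldType) (I : {mpoly K[2]} -> Prop) : {mpoly K[2]} -> Prop :=
  fun f => exists N : nat, I (f ^+ N).

Definition ideal_xy (K : fieldType) : {mpoly K[2]} -> Prop :=
  ideal_gen (fun g => g = xvar K \/ g = yvar K).

(* The monomial ideal of K[x,y] with the same monomials as the monomial ideal
   [E] of k[x,y]. *)
Definition monomial_ext (k K : fieldType) (E : {mpoly k[2]} -> Prop) :
    {mpoly K[2]} -> Prop :=
  ideal_gen (fun g => exists m, E 'X_[m] /\ g = 'X_[m]).

(* V(E), for the ideals of K[x,y]; for K = k, [monomial_ext K E] is E. *)
Definition in_V (k K : fieldType) (E : {mpoly k[2]} -> Prop)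
    (I : {mpoly K[2]} -> Prop) : Prop :=
  homogeneous_ideal I /\ forall f, Lt I f <-> monomial_ext E f.

(** * Graded Betti numbers

   Tor_i(I, K) is the i-th homology of I (x) F, for F the Koszul complex
     0 -> R(-2) -> R(-1)^2 -> R
   on x, y, which is a free resolution of K = R/(x,y): F_i = R(-i)^(C(2,i)),
   elements are row vectors and the differential F_i -> F_(i-1) is right
   multiplication by [koszul i].  Since F_i is free, I (x) F_i consists of the
   row vectors with entries in I, and its elements of degree j are those with
   entries of degree j - i. *)
Definition koszul (K : fieldType) (i : nat) :
    'M[{mpoly K[2]}]_('C(2, i), 'C(2, i.-1)) :=
  match i with
  | 1 => \matrix_(a < 2, b < 1) 'X_a
  | 2 => \matrix_(a < 1, b < 2) (if b == ord0 then yvar K else - xvar K)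
  | _ => 0
  end.

(* Exactness of 0 -> R(-2) -> R(-1)^2 -> R -> K -> 0 *)

Lemma ord2E (s : 'I_2) : s = ord0 \/ s = ord_max.
Proof. by case: s => [[|[|//]] ?]; [left | right]; apply: val_inj. Qed.

Lemma mcoeffXM (K : fieldType) n (f : {mpoly K[n]}) (i : 'I_n) (m : 'X_{1..n}) : (m i = 0)%N ->
  ('X_i * f : {mpoly K[n]})@_m = 0.
Proof.
move=> mi0; apply/eqP; rewrite mcoeff_eq0; apply/negP => /msuppM_le /allpairsP [[a b] /= [ha _ e]].
move: ha mi0; rewrite msuppX inE => /eqP ea.
by rewrite e ea mnmDE mnm1E eqxx.
Qed.

Lemma divX (K : fieldType) n (f : {mpoly K[n]}) (i : 'I_n) :
  (forall m : 'X_{1..n}, m i = 0%N -> f@_m = 0) -> exists g, f = 'X_i * g.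
Proof.
move=> h; exists (\sum_(m <- msupp f) f@_m *: 'X_[m - U_(i)]).
rewrite {1}[f]mpolyE big_distrr /=; apply: eq_big_seq => m hm.
rewrite -scalerAr -mpolyXD; congr (_ *: 'X_[_]).
rewrite addmC submK //; apply/mnm_lepP => l; rewrite mnm1E; case: eqP => // <-.
rewrite lt0n; apply/eqP => /h e; by move: hm; rewrite mcoeff_msupp e eqxx.
Qed.

Lemma koszul_exact0 (K : fieldType) (f : {mpoly K[2]}) :
  ideal_xy f <-> exists v, f%:M = v *m koszul K 1.
Proof.
have E v : (v *m koszul K 1) 0 0 = v 0 ord0 * xvar K + v 0 ord_max * yvar K.
  by rewrite mxE big_ord_recl big_ord1 !mxE (_ : lift _ _ = ord_max) //; apply: val_inj.
split.
  move=> h; apply: (h (fun f => exists v, f%:M = v *m koszul K 1)); first split.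
  - by exists 0; rewrite mul0mx; apply/matrixP=> a b; rewrite !mxE mul0rn.
  - by move=> a b [v hv] [w hw]; exists (v + w); rewrite mulmxDl -hv -hw raddfD.
  - by move=> c a [v hv]; exists (c *: v); rewrite -scalemxAl -hv scale_scalar_mx.
  move=> g hg; have [s ->] : exists s, g = 'X_s by case: hg => ->; eexists.
  exists (delta_mx 0 s); rewrite -rowE; apply/matrixP=> a b; rewrite !mxE (ord1 a) (ord1 b) //.
move=> [v] /matrixP /(_ 0 0); rewrite E mxE eqxx mulr1n => -> I [I0 ID IM] hg.
by apply: ID; apply: IM; apply: hg; [left|right].
Qed.


Lemma koszul_exact1 (K : fieldType) (v : 'rV[{mpoly K[2]}]_2) :
  v *m koszul K 1 = 0 -> exists w, v = w *m koszul K 2.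
Proof.
move/matrixP/(_ 0 0); rewrite mxE big_ord_recl big_ord1 !mxE.
rewrite (_ : lift _ _ = ord_max); last exact: val_inj.
move=> e.
have [g hg] : exists g, v 0 ord0 = yvar K * g.
  apply: divX => m m0.
  have := congr1 (mcoeff (m + U_(ord0))) e.
  rewrite mcoeffD mcoeff0 addmC mcoeffMX [_ * 'X_ord_max]mulrC mcoeffXM ?addr0 //.
  by rewrite mnmDE mnm1E m0.
exists g%:M; rewrite mul_scalar_mx; apply/matrixP=> a b; rewrite !mxE (ord1 a).
case: (ord2E b) => -> /=; first by rewrite hg mulrC.
apply: (mulIf (x := yvar K)); last first.
  rewrite mulrN mulNr; apply/eqP; rewrite -addr_eq0 -e hg; apply/eqP; ring.
by apply/eqP => /(congr1 (mcoeff U_(ord_max))); rewrite mcoeffX eqxx mcoeff0 => /eqP; rewrite oner_eq0.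
Qed.

Lemma koszul_exact2 (K : fieldType) (w : 'rV[{mpoly K[2]}]_1) :
  w *m koszul K 2 = 0 -> w = 0.
Proof.
move/matrixP/(_ 0 ord0); rewrite mxE big_ord1 !mxE eqxx => /eqP.
rewrite mulf_eq0 => /orP [/eqP e|/eqP e].
  by apply/matrixP=> a b; rewrite (ord1 a) (ord1 b) mxE.
by move: e => /(congr1 (mcoeff U_(ord_max))); rewrite mcoeffX eqxx mcoeff0 => /eqP; rewrite oner_eq0.
Qed.

Section Betti.
Variables (K : fieldType) (I : {mpoly K[2]} -> Prop).

Definition tor_chain (i : nat) (j : int) (v : 'rV[{mpoly K[2]}]_('C(2, i))) : Prop :=
  forall s, I (v 0 s) /\ is_form (j - i%:Z) (v 0 s).

Definition tor_cycle (i : nat) (j : int) (v : 'rV[{mpoly K[2]}]_('C(2, i))) : Prop :=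
  tor_chain j v /\ v *m koszul K i = 0.

Definition tor_boundary (i : nat) (j : int) (v : 'rV[{mpoly K[2]}]_('C(2, i))) : Prop :=
  exists w : 'rV[{mpoly K[2]}]_('C(2, i.+1)),
    tor_chain j w /\ v = w *m koszul K i.+1.

End Betti.

(* dim_K A/B = n, for K-subspaces B <= A of K[x,y]^r *)
Definition quotient_dim (K : fieldType) (r : nat)
    (A B : 'rV[{mpoly K[2]}]_r -> Prop) (n : nat) : Prop :=
  exists v : 'I_n -> 'rV[{mpoly K[2]}]_r,
    [/\ forall l, A (v l),
        forall c : 'I_n -> K,
          B (\sum_l (c l)%:MP *: v l) -> forall l, c l = 0
      & forall a, A a -> exists c : 'I_n -> K, B (a - \sum_l (c l)%:MP *: v l)].

Definition betti (K : fieldType) (I : {mpoly K[2]} -> Prop) (i : nat) (j : int) : nat :=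
  epsilon (inhabits 0%N)
    (quotient_dim (tor_cycle I (i := i) j) (tor_boundary I (i := i) j)).

(** * Numerical data of a monomial ideal

   Rows 1..t+1 and columns 1..t of the Hilbert-Burch matrix are indexed here
   from 0, by 'I_t.+1 and 'I_t.  Thus i : 'I_t.+1 stands for the row i+1, and
   j : 'I_t for the column j+1. *)

Section Numerics.
Variables (k : fieldType) (E : {mpoly k[2]} -> Prop).

Definition tE : nat := least (fun j => E (xvar k ^+ j)).

Definition mE (i : nat) : nat :=
  least (fun j => E (xvar k ^+ (tE - i) * yvar k ^+ j)).

(* d_(j+1) *)
Definition dE (j : 'I_tE) : nat := (mE j.+1 - mE j)%N.

(* u_(i+1,j+1) *)
Definition uE (i : 'I_tE.+1) (j : 'I_tE) : int :=
  (mE j.+1)%:Z - (mE i)%:Z + i%:Z - j%:Z.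

Definition SE : {set 'I_tE.+1 * 'I_tE} :=
  [set ij : 'I_tE.+1 * 'I_tE | (ij.2 < ij.1)%N & (0 <= uE ij.1 ij.2 < (dE ij.2)%:Z)].

(* the dimension n of the affine space; the coordinate s : 'I_nE is the one
   attached to the position [enum_val s] of S(E) *)
Definition nE : nat := #|SE|.

(* a_(i+1) *)
Definition aE (i : 'I_tE.+1) : nat := (tE - i + mE i)%N.

(* b_(j+1) = a_(j+2) + 1 *)
Definition bE (j : 'I_tE) : nat := (aE (lift ord0 j)).+1.

Definition wE (j : int) : {set 'I_tE.+1} := [set i | (aE i)%:Z == j].
Definition vE (j : int) : {set 'I_tE} := [set i | (bE i)%:Z == j].

(** * The ideals I_p, for points p with coordinates in a field K *)

Variables (K : fieldType) (p : 'I_nE -> K).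

Definition M0 : 'M[{mpoly K[2]}]_(tE.+1, tE) :=
  \matrix_(i, j) (if i == j :> nat then yvar K ^+ dE j
                  else if i == j.+1 :> nat then - xvar K else 0).

Definition Np : 'M[{mpoly K[2]}]_(tE.+1, tE) :=
  \matrix_(i, j) (if [pick s : 'I_nE | enum_val s == (i, j)] is Some s
                  then (p s)%:MP * yvar K ^+ `|uE i j|%N else 0).

Definition Mp : 'M[{mpoly K[2]}]_(tE.+1, tE) := M0 + Np.

(* The t x t minors of a (t+1) x t matrix are obtained by deleting a row. *)
Definition Ip : {mpoly K[2]} -> Prop :=
  ideal_gen (fun g => exists i : 'I_tE.+1, g = \det (row' i Mp : 'M_tE)).

Definition Mpj (j : int) : 'M[{mpoly K[2]}]_(#|wE j|, #|vE j|) :=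
  mxsub enum_val enum_val Mp.

End Numerics.

(* the rank of a matrix over an integral domain, i.e. over its fraction field *)
Definition rank_dom (R : idomainType) (m n : nat) (A : 'M[R]_(m, n)) : nat :=
  \rank (map_mx (@tofrac R) A).

(* V(E,j,>=u) and V(E,j,u) inside the affine space, through p |-> I_p *)
Definition V_ge (k K : fieldType) (E : {mpoly k[2]} -> Prop) (j u : int)
    (p : 'I_(nE E) -> K) : Prop :=
  in_V E (Ip p) /\ u <= (betti (Ip p) 0 j)%:Z.

Definition V_eq (k K : fieldType) (E : {mpoly k[2]} -> Prop) (j u : int)
    (p : 'I_(nE E) -> K) : Prop :=
  in_V E (Ip p) /\ (betti (Ip p) 0 j)%:Z = u.

(** * Topological notions, for a space given by its closed sets *)

Section Topology.
Variables (X : Type) (closed : (X -> Prop) -> Prop).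

Definition incl (Y Z : X -> Prop) : Prop := forall x, Y x -> Z x.

(* The empty set is not irreducible. *)
Definition irreducible (Z : X -> Prop) : Prop :=
  (exists x, Z x) /\
  forall F G, closed F -> closed G ->
    (forall x, Z x -> F x \/ G x) -> incl Z F \/ incl Z G.

Definition top_closure (Z : X -> Prop) : X -> Prop :=
  fun x => forall F, closed F -> incl Z F -> F x.

(* a chain Z = F_0 < F_1 < ... < F_l of irreducible closed subsets *)
Definition irr_chain (Z : X -> Prop) (l : nat) : Prop :=
  exists F : nat -> X -> Prop,
    [/\ forall x, F 0%N x <-> Z x,
        forall i, (i <= l)%N -> closed (F i) /\ irreducible (F i)
      & forall i, (i < l)%N -> incl (F i) (F i.+1) /\ ~ incl (F i.+1) (F i)].

(* codimension of an irreducible closed subset *)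
Definition has_codim (Z : X -> Prop) (c : nat) : Prop :=
  irr_chain Z c /\ forall l, irr_chain Z l -> (l <= c)%N.

End Topology.

(** * Affine space

   [k^n] with the Zariski topology is the usual model of the affine space when
   k is infinite; over an arbitrary field one needs the points of the scheme
   A^n = Spec k[X_1, ..., X_n], i.e. the prime ideals of k[X_1, ..., X_n]. *)

Definition zariski_closed (k : fieldType) (n : nat) (F : ('I_n -> k) -> Prop) : Prop :=
  exists J : {mpoly k[n]} -> Prop,
    forall p, F p <-> forall f, J f -> f.@[p] = 0.

Definition Aspec (k : fieldType) (n : nat) : Type := prime_idealr {mpoly k[n]}.

Definition spec_closed (k : fieldType) (n : nat) (F : Aspec k n -> Prop) : Prop :=
  exists J : {mpoly k[n]} -> Prop,
    forall P : Aspec k n, F P <-> forall f, J f -> f \in (P : prime_idealr _).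

(* k[X_1, ..., X_n]/P, with the structure of integral domain that is needed to
   form its field of fractions; units and inverses are chosen classically. *)
Section QuotientDomain.
Variables (k : fieldType) (n : nat) (P : prime_idealr {mpoly k[n]}).

Definition quot_dom : Type := {ideal_quot P}.
HB.instance Definition _ := GRing.ComNzRing.on quot_dom.

Definition quot_unit : {pred quot_dom} :=
  fun x => if excluded_middle_informative (exists y, y * x = 1) then true else false.

Definition quot_inv (x : quot_dom) : quot_dom :=
  if quot_unit x then epsilon (inhabits 0) (fun y => y * x = 1) else x.

Lemma quot_mulVr : {in quot_unit, left_inverse 1 quot_inv *%R}.
Proof.
move=> x ux; rewrite /quot_inv (ux : quot_unit x = true).
apply: (@epsilon_spec _ _ (fun y => y * x = 1)).
by move: ux; rewrite unfold_in /quot_unit; case: excluded_middle_informative.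
Qed.

Lemma quot_unitPl (x y : quot_dom) : y * x = 1 -> quot_unit x.
Proof.
by move=> yx1; rewrite /quot_unit; case: excluded_middle_informative => // -[]; exists y.
Qed.

Lemma quot_inv_out : {in [predC quot_unit], quot_inv =1 id}.
Proof. by move=> x /negbTE ux; rewrite /quot_inv (ux : quot_unit x = false). Qed.

HB.instance Definition _ := GRing.ComNzRing_hasMulInverse.Build quot_dom
  quot_mulVr quot_unitPl quot_inv_out.
HB.instance Definition _ := GRing.ComUnitRing_isIntegral.Build quot_dom
  (@Quotient.rquot_IdomainAxiom _ P).

Definition residue_field : fieldType := {fraction quot_dom}.

(* the coordinates of the point P, in its residue field *)
Definition coords (s : 'I_n) : residue_field :=
  tofrac (\pi_({ideal_quot P})%qT ('X_s : {mpoly k[n]}) : quot_dom).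

End QuotientDomain.

(* Main.v *)
Require Import Defs.
From Stdlib Require Import Classical ClassicalEpsilon.
From HB Require Import structures.
From mathcomp Require Import all_boot all_order all_algebra.
From mathcomp Require Import fraction generic_quotient ring_quotient.
From mathcomp Require Import mpoly.
From mathcomp Require Import zify.
Import Order.TTheory GRing.Theory Num.Theory.
Local Open Scope ring_scope.

(** The theorem reduces to linear algebra over fields, in two independent halves.
    Rows and columns of M(p), and the numbers a_i, b_j, d_j, are indexed from 0.

    Betti numbers. Let K be an extension of k, p a point with coordinates in K,
    and F_0, ..., F_t the signed maximal minors of M(p). The relations
    F M(p) = 0 express y^(d_j) F_j as x F_(j+1) plus a combination of later F_i
    with coefficients in K[y], and F_t = y^(m_t); descending induction gives
    the leading monomial x^(t-i) y^(m_i) of F_i ([F_lead_form]). The same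
    relations rewrite every element of I_p as h_0 F_0 + ... + h_t F_t with
    h_1, ..., h_t in K[y] ([all_normalizable]), and such a sum has a leading
    monomial in L unless all h_i are 0 ([normal_lead]). Hence Lt(I_p) is the
    extension of L to K[x,y] ([I_in_V]), and the columns of M(p) generate all
    syzygies ([syzygy]). So I_p/(x,y)I_p is the cokernel of the constant terms of M(p),
    and beta_(0,j)(I_p) is the number of rows of degree j minus the rank of
    M(p)_j ([betti0_E]). For L itself the matrix of constants is 0, which gives
    beta_(0,j)(L); and beta_(1,j)(L) counts the socle monomials of R/L of
    degree j - 2 ([betti1_quotient_dim]). As L is a lex-segment ideal, the a_i
    increase, all d_i are positive, and M(p)_j consists of distinct coordinates
    ([MpjE]). Therefore, with m = beta_(0,j)(L) and q = beta_(1,j)(L), V(L,j,>=u) is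
    the locus where an m x q matrix of distinct coordinates of the affine space
    has rank at most r = m - u.

    Determinantal loci. A matrix of rank at most r is a product B C through a
    space of dimension r. The locus is thus the zero set of the kernel of the
    substitution of B C for the matrix ([rank_le_iff]); the kernel is prime,
    which gives irreducibility, and the locus of rank exactly r is dense since
    the corner minor of size r is not in the kernel ([rank_eq_dense]).

    For the codimension (m-r)(q-r), take the positions (i,j) with i, j >= r. Adding
    to B C free values at more and more of these positions gives a chain of
    primes of that length, strict because of the bordered minors
    ([bordered_minor]). That no chain is longer follows by counting. The other
    n - (m-r)(q-r) coordinates are algebraically independent on the locus,
    because a matrix with indeterminate entries in its first r rows and columns
    has a completion of rank r over the field of fractions
    ([generic_completion]). Each step down in a chain of primes adds one to the
    growth exponent of the quotient ([growth_step]), which is at most n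
    ([growth_le]).

    The second half is written for a space whose points have coordinates in
    extension fields of k, subject to one density hypothesis; the spectrum of
    k[X_1, ..., X_n], with its residue fields, and k^n for infinite k are the
    two instances. *)

Set Implicit Arguments.
Unset Strict Implicit.
Unset Printing Implicit Defensive.

Lemma mpoly_ind_gen (R : comNzRingType) n (P : {mpoly R[n]} -> Prop) :
  (forall c, P c%:MP) -> (forall i, P 'X_i) ->
  (forall f g, P f -> P g -> P (f + g)) -> (forall f g, P f -> P g -> P (f * g)) ->
  forall f, P f.
Proof.
move=> PC PX PD PM; have PE f e : P f -> P (f ^+ e).
  by move=> Pf; elim: e => [|e IH]; [exact: PC|rewrite exprS; apply: PM].
elim/mpolyind => [|c m f _ _ Pf]; first exact: PC.
apply: PD => //; rewrite -mul_mpolyC; apply: (PM); first exact: PC.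
by rewrite mpolyXE_id; apply: (big_ind P) => [|p q|i _]; [exact: PC|exact: PM|apply: PE].
Qed.

(** * Dimensions of quotients *)

Section QuotientDim.
Variables (K : fieldType) (r : nat) (A B : 'rV[{mpoly K[2]}]_r -> Prop).
Hypotheses (B0 : B 0) (BD : forall v w, B v -> B w -> B (v + w))
  (BZ : forall c v, B v -> B (c%:MP *: v)).

(** Writing the first family in terms of the second modulo [B] gives an n x n'
    matrix over K. A row vector killed by it would be a relation between the
    members of the first family modulo [B], so its rows are independent. *)
Lemma quotient_dim_le n n' : quotient_dim A B n -> quotient_dim A B n' -> (n <= n')%N.
Proof.
move=> [v [vA vi _]] [w [wA _ ws]].
have [C hC] : exists C : 'M[K]_(n, n'), forall l, B (v l - \sum_s (C l s)%:MP *: w s).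
  have h l : exists c : 'rV[K]_n', B (v l - \sum_s (c 0 s)%:MP *: w s).
    have [c hc] := ws _ (vA l); exists (\row_s c s); move: hc; congr (B (_ - _)).
    by apply: eq_bigr => s _; rewrite mxE.
  exists (\matrix_l epsilon (inhabits 0) (fun c : 'rV[K]_n' => B (v l - \sum_s (c 0 s)%:MP *: w s))).
  move=> l; have := epsilon_spec (inhabits 0) _ (h l); congr (B (_ - _)).
  by apply: eq_bigr => s _; rewrite !mxE.
suff fC : row_free C by rewrite -(eqP fC) rank_leq_col.
rewrite -kermx_eq0; apply/rowV0P => c /sub_kermxP cC.
apply/rowP => l; rewrite [RHS]mxE; move: l; apply: vi.
have -> : \sum_l (c 0 l)%:MP *: v l = \sum_l (c 0 l)%:MP *: (v l - \sum_s (C l s)%:MP *: w s).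
  under [RHS]eq_bigr do rewrite scalerBr scaler_sumr; rewrite sumrB exchange_big /=.
  rewrite [X in _ - X]big1 ?subr0 // => s _.
  under eq_bigr do rewrite scalerA -mpolyCM; rewrite -scaler_suml -raddf_sum /=.
  by have /matrixP/(_ 0 s) := cC; rewrite !mxE => ->; rewrite mpolyC0 scale0r.
by apply: (big_ind B) => // l _; apply: BZ.
Qed.

Lemma quotient_dim_uniq n n' : quotient_dim A B n -> quotient_dim A B n' -> n = n'.
Proof. by move=> h h'; apply/eqP; rewrite eqn_leq !quotient_dim_le. Qed.

End QuotientDim.

(** A presentation of A/B by generators [e a] and relations, the rows of [C]: a
    basis of a complement of the row space of [C] gives a basis of A/B. *)
Lemma quotient_dim_coker (K : fieldType) (r : nat) (A B : 'rV[{mpoly K[2]}]_r -> Prop) q s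
    (e : 'I_q -> 'rV[{mpoly K[2]}]_r) (C : 'M[K]_(s, q)) :
  (forall v w, B v -> B w -> B (v + w)) ->
  (forall c v, A v -> A (c%:MP *: v)) -> (forall v w, A v -> A w -> A (v + w)) -> A 0 ->
  (forall a, A (e a)) ->
  (forall c : 'I_q -> K, B (\sum_a (c a)%:MP *: e a) <-> (\row_a c a <= C)%MS) ->
  (forall v, A v -> exists c : 'I_q -> K, B (v - \sum_a (c a)%:MP *: e a)) ->
  quotient_dim A B (q - \rank C).
Proof.
move=> BD AZ AD A0 Ae Brel Bspan; rewrite -mxrank_compl.
pose V := row_base C^C%MS.
have comb n (W : 'M[K]_(n, q)) (c : 'I_n -> K) :
    \sum_l (c l)%:MP *: (\sum_a (W l a)%:MP *: e a) =
    \sum_a (((\row_l c l) *m W) 0 a)%:MP *: e a.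
  under eq_bigr do rewrite scaler_sumr; rewrite exchange_big; apply: eq_bigr => a _ /=.
  under eq_bigr do rewrite scalerA -mpolyCM; rewrite -scaler_suml -raddf_sum /=.
  by rewrite mxE; congr (_%:MP *: _); apply: eq_bigr => l _; rewrite mxE.
exists (fun l => \sum_a (V l a)%:MP *: e a); split.
- by move=> l; apply: (big_ind A) => // a _; apply: AZ.
- move=> c; rewrite comb => /Brel; set w := \row_a _ => hw l.
  have ew : w = (\row_l c l) *m V by apply/rowP => a; rewrite mxE.
  have : (w <= C :&: C^C)%MS.
    rewrite sub_capmx hw ew; apply: submx_trans (submxMl _ _) _.
    by rewrite eq_row_base.
  rewrite capmx_compl submx0 ew => /eqP w0.
  have /rowP/(_ l) : \row_l c l = 0 by apply: (row_free_inj (row_base_free C^C%MS)); rewrite mul0mx.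
  by rewrite !mxE.
- move=> v /Bspan [c hc].
  have /sub_addsmxP [[u1 u2] /= hu] : (\row_a c a <= C + C^C)%MS.
    by apply: submx_full; apply: addsmx_compl_full.
  have /submxP [z hz] : (u2 *m C^C <= V)%MS by rewrite eq_row_base submxMl.
  exists (fun l => z 0 l).
  have hB : B (\sum_a ((u1 *m C) 0 a)%:MP *: e a).
    by apply/Brel; rewrite (_ : \row_a _ = u1 *m C) ?submxMl //; apply/rowP => a; rewrite mxE.
  rewrite comb; have := BD _ _ hc hB; congr (B _).
  rewrite -addrA; congr (_ + _); rewrite addrC -opprB; congr (- _); rewrite -sumrB; apply: eq_bigr => a _.
  rewrite -scalerBl -mpolyCB; congr (_%:MP *: _).
  have /rowP/(_ a) := hu; rewrite [LHS]mxE [RHS]mxE => ->; rewrite [X in X - _]addrC addrK hz.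
  by congr ((_ *m V) 0 a); apply/rowP => l; rewrite mxE.
Qed.

(** * Forms and homogeneous components *)

Section Forms.
Variable K : fieldType.
Implicit Types (f g h : {mpoly K[2]}) (d e : int) (m : 'X_{1..2}).

Lemma is_formP d f : reflect (forall m, f@_m != 0 -> (mdeg m)%:Z = d) (is_form d f).
Proof.
apply: (iffP allP) => h m; first by rewrite -mcoeff_msupp => /h /eqP.
by rewrite mcoeff_msupp => /h ->.
Qed.

Lemma is_form0 d : is_form d (0 : {mpoly K[2]}).
Proof. by apply/is_formP => m; rewrite mcoeff0 eqxx. Qed.

Lemma is_formD d f g : is_form d f -> is_form d g -> is_form d (f + g).
Proof.
move=> /is_formP hf /is_formP hg; apply/is_formP => m; rewrite mcoeffD => hm.
have [e|/hf //] := eqVneq f@_m 0; apply: hg; by rewrite e add0r in hm.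
Qed.

Lemma is_formM d e f g : is_form d f -> is_form e g -> is_form (d + e) (f * g).
Proof.
move=> /allP hf /allP hg; apply/allP => m /msuppM_le /allpairsP [[a b] /= [ha hb ->]].
by rewrite mdegD PoszD (eqP (hf _ ha)) (eqP (hg _ hb)).
Qed.

Lemma is_formC c : is_form 0 (c%:MP : {mpoly K[2]}).
Proof.
apply/is_formP => m; rewrite mcoeffC.
by have [->|] := eqVneq m 0%MM; rewrite ?mdeg0 // mulr0 eqxx.
Qed.

Lemma is_formX m : is_form (mdeg m) ('X_[m] : {mpoly K[2]}).
Proof. by apply/allP => m'; rewrite msuppX inE => /eqP ->. Qed.

Lemma is_formN d f : is_form d f -> is_form d (- f).
Proof. by move=> h; rewrite -mulN1r -[d]add0r -(mpolyC1 2 K) -mpolyCN is_formM ?is_formC. Qed.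

Lemma is_form_sum I (r : seq I) (P : pred I) d (F : I -> {mpoly K[2]}) :
  (forall i, P i -> is_form d (F i)) -> is_form d (\sum_(i <- r | P i) F i).
Proof.
by move=> h; apply: (big_ind (is_form d)) => //; [apply: is_form0 | move=> p q; apply: is_formD].
Qed.

Lemma is_formZ c d f : is_form d f -> is_form d (c%:MP * f).
Proof. by move=> h; rewrite -[d]add0r is_formM ?is_formC. Qed.

(** With [d] an integer, the component is 0 in negative degrees, and degrees can
    be shifted without side conditions. *)
Definition hcomp d f : {mpoly K[2]} := \sum_(m <- msupp f | (mdeg m)%:Z == d) f@_m *: 'X_[m].

Lemma mcoeff_hcomp d f m : (hcomp d f)@_m = if (mdeg m)%:Z == d then f@_m else 0.
Proof.
rewrite /hcomp raddf_sum /=; under eq_bigr do rewrite mcoeffZ mcoeffX.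
have [hm|hm] := boolP (m \in msupp f); last first.
  rewrite big1_seq ?(memN_msupp_eq0 hm) ?if_same // => m' /andP[_ hm'].
  by case: eqP => [e|_]; [rewrite -e hm' in hm | rewrite mulr0].
rewrite -big_filter; set s := [seq _ <- _ | _].
case: ifP => hd; last first.
  rewrite big1_seq // => m'; rewrite mem_filter => /andP [_ /andP[h _]].
  have [e|_] := eqVneq m' m; last by rewrite mulr0.
  by rewrite -e h in hd.
rewrite (bigD1_seq m) /= ?filter_uniq ?msupp_uniq // ?mem_filter ?hd //.
rewrite eqxx mulr1 big1 ?addr0 // => m' /negbTE ->; by rewrite mulr0.
Qed.

Lemma is_form_hcomp d f : is_form d (hcomp d f).
Proof. by apply/is_formP => m; rewrite mcoeff_hcomp; case: ifP => [/eqP //|_]; rewrite eqxx. Qed.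

Lemma hcomp_id d f : is_form d f -> hcomp d f = f.
Proof.
move=> /is_formP h; apply/mpolyP => m; rewrite mcoeff_hcomp; case: ifP => // hm.
by apply/esym/eqP; apply: contraFT hm => /h/eqP.
Qed.

Lemma hcomp_neq d e f : is_form d f -> e != d -> hcomp e f = 0.
Proof.
move=> /is_formP h ne; apply/mpolyP => m; rewrite mcoeff_hcomp mcoeff0; case: ifP => // /eqP hm.
by apply/eqP; apply: contraNT ne => /h <-; rewrite hm.
Qed.

Lemma hcompD d : {morph hcomp d : f g / f + g}.
Proof.
by move=> f g; apply/mpolyP => m; rewrite mcoeffD !mcoeff_hcomp mcoeffD; case: ifP; rewrite ?addr0.
Qed.

Lemma hcomp0 d : hcomp d 0 = 0.
Proof. by apply/mpolyP => m; rewrite mcoeff_hcomp mcoeff0 if_same. Qed.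

Lemma hcomp_sum d I (r : seq I) (P : pred I) (F : I -> {mpoly K[2]}) :
  hcomp d (\sum_(i <- r | P i) F i) = \sum_(i <- r | P i) hcomp d (F i).
Proof. by apply: big_morph; [apply: hcompD | apply: hcomp0]. Qed.

Lemma hcompM d e f g : is_form e f -> hcomp d (f * g) = f * hcomp (d - e) g.
Proof.
move=> hf; rewrite [g in LHS]mpolyE mulr_sumr hcomp_sum [g in RHS]mpolyE hcomp_sum mulr_sumr.
apply: eq_bigr => m _; rewrite -mul_mpolyC.
have hX : is_form (mdeg m)%:Z ((g@_m)%:MP * 'X_[m] : {mpoly K[2]}) by apply/is_formZ/is_formX.
have [E|ne] := eqVneq (mdeg m)%:Z (d - e).
  by rewrite -E (hcomp_id hX) hcomp_id //; move: (is_formM hf hX); rewrite E [e + _]addrC subrK.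
rewrite (hcomp_neq hX) ?mulr0; last by rewrite eq_sym.
apply: (hcomp_neq (is_formM hf hX)); apply: contraNneq ne => ->; by rewrite [e + _]addrC addrK.
Qed.

Lemma is_formM_cancel d e f g : f != 0 -> is_form d f -> is_form e (f * g) -> is_form (e - d) g.
Proof.
move=> f0 hf hfg; rewrite -[g](_ : hcomp (e - d) g = g) ?is_form_hcomp //.
by apply: (mulfI f0); rewrite -hcompM // hcomp_id.
Qed.

End Forms.

(** * Leading monomials *)

Section Lead.
Variable K : fieldType.
Implicit Types (f g h : {mpoly K[2]}) (m : 'X_{1..2}).

Lemma mnm2P m m' : m ord0 = m' ord0 -> m ord_max = m' ord_max -> m = m'.
Proof. by move=> h0 h1; apply/mnmP => i; case: (ord2E i) => ->. Qed.

Lemma mdeg2 m : mdeg m = (m ord0 + m ord_max)%N.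
Proof.
rewrite mdegE big_ord_recl big_ord1; congr (_ + m _)%N; exact: val_inj.
Qed.

Lemma lex_lt_trans m1 m2 m3 : lex_lt m1 m2 -> lex_lt m2 m3 -> lex_lt m1 m3.
Proof. by rewrite /lex_lt; lia. Qed.

Lemma lex_lt_irr m : lex_lt m m = false.
Proof. by rewrite /lex_lt; lia. Qed.

Lemma lex_total m m' : [\/ m = m', lex_lt m m' | lex_lt m' m].
Proof.
rewrite /lex_lt.
have [h|h|h0] := ltngtP (m ord0) (m' ord0); [by constructor 2|by constructor 3|].
have [h|h|h1] := ltngtP (m ord_max) (m' ord_max); rewrite ?h0 ?eqxx /=.
- by constructor 2. - by constructor 3. - by constructor 1; apply: mnm2P.
Qed.

Lemma leadP f m : is_lead_monomial f m <->
  f@_m != 0 /\ forall m', f@_m' != 0 -> m' = m \/ lex_lt m' m.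
Proof.
rewrite /is_lead_monomial mcoeff_msupp; split=> -[h1 h2]; split=> // m'.
  by rewrite -mcoeff_msupp; apply: h2.
by rewrite mcoeff_msupp; apply: h2.
Qed.

Lemma lead_uniq f m m' : is_lead_monomial f m -> is_lead_monomial f m' -> m = m'.
Proof.
move=> [h1 h2] [h3 h4]; case: (h2 _ h3) => // l; case: (h4 _ h1) => // l'.
by have := lex_lt_trans l l'; rewrite lex_lt_irr.
Qed.

Lemma lead_neq0 f m : is_lead_monomial f m -> f != 0.
Proof. by move=> /leadP [h _]; apply: contraNneq h => ->; rewrite mcoeff0. Qed.

Lemma lead_exists f : f != 0 -> exists m, is_lead_monomial f m.
Proof.
rewrite -msupp_eq0 /is_lead_monomial; elim: (msupp f) => // m s IH _.
case: s IH => [|m1 s] IH.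
  by exists m; rewrite inE eqxx; split=> // m'; rewrite inE => /eqP ->; left.
have [//|m0 [h1 h2]] := IH.
case: (lex_total m m0) => [e|l|l].
- exists m0; split; first by rewrite inE h1 orbT.
  by move=> m'; rewrite inE => /orP[/eqP->|/h2 //]; left.
- exists m0; split; first by rewrite inE h1 orbT.
  by move=> m'; rewrite inE => /orP[/eqP->|/h2 //]; right.
- exists m; split; first by rewrite inE eqxx.
  move=> m'; rewrite inE => /orP[/eqP->|/h2 [->|l']]; [by left|by right|right].
  exact: lex_lt_trans l' l.
Qed.

(** Since the order is compatible with sums of exponents, the product of the two
    leading terms is the only contribution to the monomial [m + n]. *)
Lemma leadM f g m n : is_lead_monomial f m -> is_lead_monomial g n ->
  is_lead_monomial (f * g) (m + n).
Proof.
move=> /leadP [fm hf] /leadP [gn hg]; apply/leadP; split; last first.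
  move=> m'; rewrite -mcoeff_msupp => /msuppM_le /allpairsP [[a b] /= [ha hb ->]].
  rewrite mcoeff_msupp in ha; rewrite mcoeff_msupp in hb.
  case: (hf _ ha) => [->|la]; case: (hg _ hb) => [->|lb]; [by left|right..];
    move: (la) (lb) || move: (la) || move: (lb); rewrite /lex_lt !mnmDE; lia.
rewrite mcoeffM.
have m1 : (mdeg m < (mdeg (m + n)).+1)%N by rewrite mdegD ltnS leq_addr.
have n1 : (mdeg n < (mdeg (m + n)).+1)%N by rewrite mdegD ltnS leq_addl.
rewrite (bigD1 (BMultinom m1, BMultinom n1)) //= big1 ?addr0 ?mulf_neq0 //.
move=> [a b] /= /andP[/eqP e ne]; apply/eqP; apply: contraNT ne.
rewrite mulf_eq0 negb_or => /andP[ha hb].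
have [ea eb] : m = a /\ n = b.
  have e0 := congr1 (fun m : 'X_{1..2} => m ord0) e.
  have e1 := congr1 (fun m : 'X_{1..2} => m ord_max) e.
  rewrite /= !mnmDE in e0 e1.
  by case: (hf _ ha) (hg _ hb) => [ea|la] [eb|lb]; split=> //; apply: mnm2P;
    try (by rewrite ?ea ?eb); exfalso; move: e0 e1; rewrite ?ea ?eb;
    move: (la) (lb) || move: (la) || move: (lb); rewrite /lex_lt; lia.
by apply/eqP; congr (_, _); apply: val_inj.
Qed.

Lemma leadX m : is_lead_monomial ('X_[m] : {mpoly K[2]}) m.
Proof.
by split=> [|m']; rewrite msuppX inE // => /eqP ->; left.
Qed.

Lemma leadD f g m : is_lead_monomial f m -> (forall m', g@_m' != 0 -> lex_lt m' m) ->
  is_lead_monomial (f + g) m.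
Proof.
move=> /leadP [fm hf] hg; apply/leadP; split.
  rewrite mcoeffD (_ : g@_m = 0) ?addr0 //; apply/eqP; apply: contraT => /hg.
  by rewrite lex_lt_irr.
move=> m'; rewrite mcoeffD => h; have [e|/hf //] := eqVneq f@_m' 0.
by right; apply: hg; rewrite e add0r in h.
Qed.

End Lead.

(** * Cycles and boundaries of the Koszul complex *)

Lemma mxDE (R : nmodType) q r (B C : 'M[R]_(q, r)) a b : (B + C) a b = B a b + C a b.
Proof. by rewrite mxE. Qed.

Lemma mxBE (R : zmodType) q r (B C : 'M[R]_(q, r)) a b : (B - C) a b = B a b - C a b.
Proof. by rewrite !mxE. Qed.

Lemma mxZE (R : pzRingType) q r c (B : 'M[R]_(q, r)) a b : (c *: B) a b = c * B a b.
Proof. by rewrite mxE. Qed.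

Section Tor.
Variables (K : fieldType) (I : {mpoly K[2]} -> Prop) (i : nat) (j : int).
Hypothesis I_ideal : is_ideal I.

Lemma tor_chain0 : tor_chain I (i := i) j 0.
Proof. by move=> s; rewrite mxE is_form0; have [I0 _ _] := I_ideal. Qed.

Lemma tor_chainD v w :
  tor_chain I (i := i) j v -> tor_chain I (i := i) j w -> tor_chain I (i := i) j (v + w).
Proof.
move=> hv hw s; have [Iv fv] := hv s; have [Iw fw] := hw s; have [_ ID _] := I_ideal.
by rewrite mxDE is_formD //; split=> //; apply: ID.
Qed.

Lemma tor_chainZ c v : tor_chain I (i := i) j v -> tor_chain I (i := i) j (c%:MP *: v).
Proof.
move=> hv s; have [Iv fv] := hv s; have [_ _ IM] := I_ideal.
by rewrite mxZE is_formZ //; split=> //; apply: IM.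
Qed.

End Tor.

Section TorHomology.
Variables (K : fieldType) (I : {mpoly K[2]} -> Prop) (i : nat) (j : int).
Hypothesis I_ideal : is_ideal I.

Lemma tor_cycle0 : tor_cycle I (i := i) j 0.
Proof. by split; [apply: tor_chain0 | rewrite mul0mx]. Qed.

Lemma tor_cycleD v w :
  tor_cycle I (i := i) j v -> tor_cycle I (i := i) j w -> tor_cycle I (i := i) j (v + w).
Proof.
by move=> [cv v0] [cw w0]; split; [apply: tor_chainD | rewrite mulmxDl v0 w0 addr0].
Qed.

Lemma tor_cycleZ c v : tor_cycle I (i := i) j v -> tor_cycle I (i := i) j (c%:MP *: v).
Proof.
by move=> [cv v0]; split; [apply: tor_chainZ | rewrite -scalemxAl v0 scaler0].
Qed.

Lemma tor_boundary0 : tor_boundary I (i := i) j 0.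
Proof. by exists 0; rewrite mul0mx; split=> //; apply: tor_chain0. Qed.

Lemma tor_boundaryD v w : tor_boundary I (i := i) j v -> tor_boundary I (i := i) j w ->
  tor_boundary I (i := i) j (v + w).
Proof.
move=> [v' [hv ->]] [w' [hw ->]]; exists (v' + w'); rewrite mulmxDl.
by split=> //; apply: tor_chainD.
Qed.

Lemma tor_boundaryZ c v : tor_boundary I (i := i) j v -> tor_boundary I (i := i) j (c%:MP *: v).
Proof.
move=> [v' [hv ->]]; exists (c%:MP *: v'); rewrite scalemxAl.
by split=> //; apply: tor_chainZ.
Qed.

(** [betti] selects some dimension of the homology; there is only one since the
    boundaries form a subspace. *)
Lemma bettiE n : quotient_dim (tor_cycle I (i := i) j) (tor_boundary I (i := i) j) n ->
  betti I i j = n.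
Proof.
move=> h; apply: (quotient_dim_uniq tor_boundary0 tor_boundaryD tor_boundaryZ _ h).
by apply: epsilon_spec; exists n.
Qed.

End TorHomology.

(** * Monomials of a lex-segment ideal *)

Lemma least_spec (P : nat -> Prop) : (exists n, P n) ->
  P (least P) /\ forall n, P n -> (least P <= n)%N.
Proof.
move=> exP; apply: (@epsilon_spec _ _ (fun n => P n /\ forall n', P n' -> (n <= n')%N)).
apply: NNPP => h; case: exP => n; elim/ltn_ind: n => n IH Pn; apply: h; exists n.
by split=> // n' Pn'; rewrite leqNgt; apply/negP => /IH; apply.
Qed.

Definition mono2 (a b : nat) : 'X_{1..2} := [multinom if i == ord0 then a else b | i < 2].

Lemma mono2E0 a b : mono2 a b ord0 = a.
Proof. by rewrite mnmE. Qed.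

Lemma mono2E1 a b : mono2 a b ord_max = b.
Proof. by rewrite mnmE. Qed.

Definition mono2E := (mono2E0, mono2E1).

Lemma mono2_eta (m : 'X_{1..2}) : m = mono2 (m ord0) (m ord_max).
Proof. by apply: mnm2P; rewrite mono2E. Qed.

Lemma XX_mono2 (K : fieldType) a b : xvar K ^+ a * yvar K ^+ b = 'X_[mono2 a b].
Proof.
rewrite !mpolyXn -mpolyXD; congr 'X_[_].
by apply: mnm2P; rewrite mono2E mnmDE !mulmnE !mnm1E /= ?mul1n ?mul0n ?addn0 ?add0n.
Qed.

Lemma X_mono2 (K : fieldType) a : xvar K ^+ a = 'X_[mono2 a 0].
Proof. by rewrite -XX_mono2 expr0 mulr1. Qed.

Lemma ideal_genP (R : comNzRingType) (A : R -> Prop) : is_ideal (ideal_gen A).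
Proof.
split=> [I|f g hf hg I|h f hf I] [I0 ID IM] AI //.
- by apply: (ID _ _ (hf I _ AI) (hg I _ AI)).
- by apply: (IM _ _ (hf I _ AI)).
Qed.

Lemma ideal_gen_sub (R : comNzRingType) (A : R -> Prop) g : A g -> ideal_gen A g.
Proof. by move=> Ag I _; apply. Qed.

Lemma ideal_gen_mono (R : comNzRingType) (A B : R -> Prop) f :
  (forall g, A g -> ideal_gen B g) -> ideal_gen A f -> ideal_gen B f.
Proof. by move=> h hf; apply: hf h; apply: ideal_genP. Qed.

Lemma ideal_sum (R : comNzRingType) (J : R -> Prop) I (r : seq I) (P : pred I) (F : I -> R) :
  is_ideal J -> (forall i, P i -> J (F i)) -> J (\sum_(i <- r | P i) F i).
Proof. by move=> [J0 JD _]; apply: big_ind. Qed.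

Lemma ideal_sum_seq (R : comNzRingType) (J : R -> Prop) (I : eqType) (r : seq I) (F : I -> R) :
  is_ideal J -> (forall i, i \in r -> J (F i)) -> J (\sum_(i <- r) F i).
Proof.
move=> iJ h; rewrite big_seq; exact: ideal_sum.
Qed.

Lemma mpolyX_dvd (K : fieldType) (m m' : 'X_{1..2}) :
  (m ord0 <= m' ord0)%N -> (m ord_max <= m' ord_max)%N ->
  'X_[m'] = 'X_[m' - m] * 'X_[m] :> {mpoly K[2]}.
Proof.
move=> h0 h1; rewrite -mpolyXD submK //; apply/mnm_lepP => i.
by case: (ord2E i) => ->.
Qed.

Lemma ideal_xy_const0 (K : fieldType) (f : {mpoly K[2]}) : f@_0%MM = 0 -> ideal_xy f.
Proof.
move=> f0; rewrite [f]mpolyE; apply: ideal_sum_seq; first exact: ideal_genP.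
move=> n; rewrite mcoeff_msupp => hn; rewrite -mul_mpolyC.
have [_ _ JM] := ideal_genP (fun g => g = xvar K \/ g = yvar K).
apply: (JM); have [i hi] : exists i, n i != 0%N.
  apply/existsP; apply: contraR hn => /existsPn h; rewrite (_ : n = 0%MM) ?f0 //.
  by apply/mnmP => i; rewrite mnm0E; have /negPn/eqP := h i.
rewrite -[n](submK (m := U_(i)%MM)); last first.
  by apply/mnm_lepP => l; rewrite mnm1E; case: eqP => // <-; rewrite lt0n.
rewrite mpolyXD; apply: (JM); apply: ideal_gen_sub; have [->|->] := ord2E i; by [left|right].
Qed.

Section LexSegment.
Variables (k : fieldType) (L : {mpoly k[2]} -> Prop).

Lemma monomial_extP (K : fieldType) (f : {mpoly K[2]}) : is_ideal L ->
  monomial_ext L f <-> forall m, f@_m != 0 -> L 'X_[m].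
Proof.
move=> [_ _ LM]; split=> [h|h].
  apply: (h (fun f => forall m, f@_m != 0 -> L 'X_[m])); first split.
  - by move=> m; rewrite mcoeff0 eqxx.
  - move=> p q hp hq m; rewrite mcoeffD => hm.
    by have [e|/hp //] := eqVneq p@_m 0; apply: hq; rewrite e add0r in hm.
  - move=> p q hq m; rewrite -mcoeff_msupp => /msuppM_le /allpairsP [[a b] /= [_ hb ->]].
    by rewrite mpolyXD; apply/LM/hq; rewrite -mcoeff_msupp.
  - move=> g [m [Lm ->]] m'; rewrite mcoeffX; have [<- //|_] := eqVneq m m'; by rewrite eqxx.
have iE := ideal_genP (fun g : {mpoly K[2]} => exists m, L 'X_[m] /\ g = 'X_[m]).
rewrite [f]mpolyE; apply: ideal_sum_seq => // m; rewrite mcoeff_msupp => /h hm.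
rewrite -mul_mpolyC; case: iE => _ _; apply; apply: ideal_gen_sub; by exists m.
Qed.

Hypothesis L_mon : monomial_ideal L.

Lemma monomial_idealP (f : {mpoly k[2]}) : L f <-> forall m, f@_m != 0 -> L 'X_[m].
Proof.
have [iL hL] := L_mon; rewrite -(monomial_extP f iL); split=> [/hL h|h].
  by move: h; apply: ideal_gen_mono => g [Lg [m e]]; apply: ideal_gen_sub; exists m; rewrite -e.
by apply: h => // g [m [Lm ->]].
Qed.

Hypothesis L_rad : forall f, radical L f <-> ideal_xy f.
Hypothesis L_lex : lex_segment_ideal L.

Notation E a b := (L 'X_[mono2 a b]).

Lemma E_le a b a' b' : (a <= a')%N -> (b <= b')%N -> E a b -> E a' b'.
Proof.
move=> ha hb h; rewrite (@mpolyX_dvd k (mono2 a b)) ?mono2E //.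
by have [[_ _ IM] _] := L_mon; apply: IM.
Qed.

Lemma E_xpow : exists a, E a 0.
Proof.
have /L_rad [N hN] : ideal_xy (xvar k) by apply: ideal_gen_sub; left.
by exists N; rewrite -X_mono2.
Qed.

Lemma E_ypow : exists b, E 0 b.
Proof.
have /L_rad [N hN] : ideal_xy (yvar k) by apply: ideal_gen_sub; right.
by exists N; rewrite -XX_mono2 expr0 mul1r.
Qed.

Local Notation t := (tE L).
Local Notation m := (mE L).

Lemma tE_spec : E t 0 /\ forall a, E a 0 -> (t <= a)%N.
Proof.
have [|h1 h2] := @least_spec (fun j => L (xvar k ^+ j)).
  by have [a ha] := E_xpow; exists a; rewrite X_mono2.
by rewrite -X_mono2; split=> // a; rewrite -X_mono2; apply: h2.
Qed.

Lemma mE_spec i b : E (t - i) b <-> (m i <= b)%N.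
Proof.
have [|h1 h2] := @least_spec (fun j => L (xvar k ^+ (t - i) * yvar k ^+ j)).
  have [b' hb] := E_ypow; exists b'; rewrite XX_mono2; exact: E_le hb.
split=> [h|h]; first by apply: h2; rewrite XX_mono2.
by move: h1; rewrite XX_mono2; apply: E_le.
Qed.

Lemma mE0 : m 0 = 0%N.
Proof. by apply/eqP; rewrite -leqn0; apply/mE_spec; rewrite subn0; case: tE_spec. Qed.

(** The lex-segment property applied to x^(t-i-1) y^(m_(i+1)): replacing one y by
    an x gives the larger monomial x^(t-i) y^(m_(i+1) - 1), which is thus in L. *)
Lemma mE_lt i : (i < t)%N -> (m i < m i.+1)%N.
Proof.
move=> it; have h : E (t - i.+1) (m i.+1) by apply/mE_spec.
case e : (m i.+1) h => [|c] h.
  by have := (proj2 tE_spec) _ h; lia.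
rewrite ltnS; apply/mE_spec; have [_ lex] := L_lex.
apply: lex h; rewrite ?mdeg2 /lex_lt !mono2E; lia.
Qed.

Lemma E_iff a b : E a b <-> (t <= a)%N \/ exists2 i, (i <= t)%N & a = (t - i)%N /\ (m i <= b)%N.
Proof.
split=> [h|[h|[i ti [-> /mE_spec //]]]]; last by apply: E_le (proj1 tE_spec).
have [h1|h1] := leqP t a; [by left|right]; exists (t - a)%N; first exact: leq_subr.
by rewrite (subKn (ltnW h1)); split=> //; apply: (proj1 (mE_spec _ _)); rewrite (subKn (ltnW h1)).
Qed.

Lemma dE_gt0 (j : 'I_(tE L)) : (0 < dE j)%N.
Proof. by rewrite subn_gt0 mE_lt. Qed.

Lemma dE_add (j : 'I_(tE L)) : (m j + dE j)%N = m j.+1.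
Proof. by rewrite subnKC // ltnW // mE_lt. Qed.

(** The difference a_(i+1) - a_i is d_i - 1, which is nonnegative as d_i > 0. *)
Lemma aE_le (i i' : 'I_(tE L).+1) : (i <= i')%N -> (aE i <= aE i')%N.
Proof.
case: i' => i' /= h' ; elim: i' h' => [h'|i' IH h']; first by rewrite leqn0 => /eqP e; rewrite /aE e.
rewrite leq_eqVlt => /orP[/eqP e|h]; first by rewrite /aE e.
apply: leq_trans (IH (ltnW h') h) _; have := @mE_lt i' h'; rewrite /aE /=; lia.
Qed.

Lemma bE_val (j : 'I_(tE L)) : bE j = (t - j + m j.+1)%N.
Proof. rewrite /bE /aE /= /bump /= add1n; have := ltn_ord j; lia. Qed.

Lemma uE_ab (i : 'I_(tE L).+1) (j : 'I_(tE L)) : uE i j = (bE j)%:Z - (aE i)%:Z.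
Proof.
rewrite bE_val /uE /aE; have := ltn_ord i; have := ltn_ord j; lia.
Qed.

(** Because the a_i increase with i and b_j = a_(j+1) + 1, an entry of degree 0
    can only be strictly below the entry -x of its column. *)
Lemma S_degree0 (i : 'I_(tE L).+1) (j : 'I_(tE L)) : bE j = aE i -> (i, j) \in SE L.
Proof.
move=> e; rewrite inE /= uE_ab e subrr lexx /= ltz_nat dE_gt0 andbT.
rewrite ltnNge; apply/negP => h; have := @aE_le i (lift ord0 j).
by rewrite /= /bump /= -e /bE add1n (leq_trans h) // => /(_ isT); rewrite ltnn.
Qed.

(** * Entries of the Hilbert-Burch matrix *)

Section Matrix.
Variables (K : fieldType) (p : 'I_(nE L) -> K).

Lemma NpE_out (i : 'I_(tE L).+1) (j : 'I_(tE L)) : (i, j) \notin SE L -> Np p i j = 0.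
Proof.
move=> h; rewrite mxE; case: pickP => // s /eqP e.
by rewrite -e enum_valP in h.
Qed.

Lemma NpE_in (s : 'I_(nE L)) (i : 'I_(tE L).+1) (j : 'I_(tE L)) : enum_val s = (i, j) ->
  Np p i j = (p s)%:MP * yvar K ^+ `|uE i j|%N.
Proof.
move=> e; rewrite mxE; case: pickP => [s' /eqP|/(_ s)]; last by rewrite e eqxx.
by rewrite -e => /enum_val_inj ->.
Qed.

Lemma SE_Np (i : 'I_(tE L).+1) (j : 'I_(tE L)) : (i, j) \in SE L -> exists s : 'I_(nE L), enum_val s = (i, j).
Proof. by move=> h; exists (enum_rank_in h (i, j)); rewrite enum_rankK_in. Qed.

(** Reduces the degrees and the absence of x in N to the two kinds of entries. *)
Lemma NpP (Q : {mpoly K[2]} -> Prop) (i : 'I_(tE L).+1) (j : 'I_(tE L)) : Q 0 ->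
  (forall s : 'I_(nE L), (j < i)%N -> 0 <= uE i j -> Q ((p s)%:MP * yvar K ^+ `|uE i j|%N)) ->
  Q (Np p i j).
Proof.
move=> Q0 QS; have [h|h] := boolP ((i, j) \in SE L); last by rewrite NpE_out.
have [s e] := SE_Np h; rewrite (NpE_in e); move: h; rewrite inE /= => /andP[h1 /andP[h2 _]].
exact: QS.
Qed.

Lemma Np_upper (i : 'I_(tE L).+1) (j : 'I_(tE L)) : (i <= j)%N -> Np p i j = 0.
Proof. by move=> h; apply: (NpP (Q := fun f => f = 0)) => // s; rewrite ltnNge h. Qed.

Lemma is_form_yn n : is_form n%:Z (yvar K ^+ n).
Proof. by rewrite mpolyXn; have := is_formX K (U_(ord_max) *+ n)%MM; rewrite mdegMn mdeg1 mul1n. Qed.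

Lemma is_form_Np (i : 'I_(tE L).+1) (j : 'I_(tE L)) : is_form ((bE j)%:Z - (aE i)%:Z) (Np p i j).
Proof.
apply: (NpP (Q := fun f => is_form _ f)) => [|s _ u0]; first exact: is_form0.
by rewrite -uE_ab -{1}(gez0_abs u0); apply/is_formZ/is_form_yn.
Qed.

Lemma is_form_M0 (i : 'I_(tE L).+1) (j : 'I_(tE L)) : is_form ((bE j)%:Z - (aE i)%:Z) (M0 L K i j).
Proof.
rewrite mxE; case: eqP => [e|_].
  rewrite (_ : _ - _ = (dE j)%:Z) ?is_form_yn // -uE_ab /uE e -dE_add; lia.
case: eqP => [e|_]; last exact: is_form0.
rewrite (_ : _ - _ = 1) ?is_formN //; last by rewrite -uE_ab /uE e; lia.
by have := is_formX K U_(ord0)%MM; rewrite mdeg1.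
Qed.

Lemma is_form_Mp (i : 'I_(tE L).+1) (j : 'I_(tE L)) : is_form ((bE j)%:Z - (aE i)%:Z) (Mp p i j).
Proof. by rewrite mxE is_formD ?is_form_M0 ?is_form_Np. Qed.

Definition xfree (f : {mpoly K[2]}) : bool := all (fun m : 'X_{1..2} => m ord0 == 0%N) (msupp f).

Lemma xfreeP f : reflect (forall m, f@_m != 0 -> m ord0 = 0%N) (xfree f).
Proof.
apply: (iffP allP) => h n; first by rewrite -mcoeff_msupp => /h /eqP.
by rewrite mcoeff_msupp => /h ->.
Qed.

Lemma xfree0 : xfree 0.
Proof. by rewrite /xfree msupp0. Qed.

Lemma xfreeD f g : xfree f -> xfree g -> xfree (f + g).
Proof.
move=> /allP hf /allP hg; apply/allP => n /msuppD_le; rewrite mem_cat => /orP[]; auto.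
Qed.

Lemma xfreeM f g : xfree f -> xfree g -> xfree (f * g).
Proof.
move=> /allP hf /allP hg; apply/allP => n /msuppM_le /allpairsP [[a b] /= [ha hb ->]].
by rewrite mnmDE (eqP (hf _ ha)) (eqP (hg _ hb)).
Qed.

Lemma xfreeC c : xfree c%:MP.
Proof.
apply/xfreeP => n; rewrite mcoeffC; have [->|] := eqVneq n 0%MM; first by rewrite mnm0E.
by rewrite mulr0 eqxx.
Qed.

Lemma xfree_yn n : xfree (yvar K ^+ n).
Proof. by rewrite mpolyXn /xfree msuppX /= mulmnE mnm1E /=. Qed.

Lemma xfree_sum I (r : seq I) (P : pred I) (F : I -> {mpoly K[2]}) :
  (forall i, P i -> xfree (F i)) -> xfree (\sum_(i <- r | P i) F i).
Proof. by move=> h; apply: (big_ind xfree) => //; [apply: xfree0 | move=> f g; apply: xfreeD]. Qed.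

Lemma xfree_Np i j : xfree (Np p i j).
Proof.
by apply: (NpP (Q := fun f => xfree f)) => [|s _ _]; rewrite ?xfree0 ?xfreeM ?xfreeC ?xfree_yn.
Qed.

(** Entries are forms of degree b_j - a_i, so constants occur only for b_j = a_i,
    where the entries y^d and -x of M_0(L) contribute nothing. *)
Lemma Mp_const (i : 'I_(tE L).+1) (j : 'I_(tE L)) : (Mp p i j)@_0%MM = if bE j == aE i then (Np p i j)@_0%MM else 0.
Proof.
case: ifP => h.
  rewrite mxE mcoeffD [X in X + _](_ : _ = 0) ?add0r // mxE.
  case: eqP => _; first by rewrite mpolyXn mcoeffX -mdeg_eq0 mdegMn mdeg1 mul1n -leqn0 leqNgt dE_gt0.
  by case: eqP => _; rewrite ?mcoeff0 // mcoeffN mcoeffX -mdeg_eq0 mdeg1 oppr0.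
have /is_formP H := is_form_Mp i j; apply/eqP; apply: contraFT h => /H.
by rewrite mdeg0 => /esym/eqP; rewrite subr_eq0 => /eqP [->].
Qed.

Lemma Np_const s i j : enum_val s = (i, j) -> bE j = aE i -> Np p i j = (p s)%:MP.
Proof. by move=> /NpE_in -> e; rewrite uE_ab e subrr expr0 mulr1. Qed.

End Matrix.

End LexSegment.

(** * Ideals presented by the Hilbert-Burch matrix *)

Section HilbertBurch.
Variables (k : fieldType) (L : {mpoly k[2]} -> Prop).
Hypothesis L_rad : forall f, radical L f <-> ideal_xy f.
Hypothesis L_lex : lex_segment_ideal L.
Let L_mon : monomial_ideal L := proj1 L_lex.

Local Notation t := (tE L).
Local Notation m := (mE L).

Variables (K : fieldType) (p : 'I_(nE L) -> K).
Notation M := (Mp p).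
Notation R := {mpoly K[2]}.
(** The argument needs no minors, only a row [F] with F M(p) = 0 whose last entry
    is y^(m_t). This covers both the signed minors of M(p) and, for p = 0, the
    monomial generators of L. *)
Variables (F : 'rV[R]_t.+1) (I : R -> Prop).
Hypotheses (FM : F *m M = 0) (Ft : F 0 ord_max = yvar K ^+ m t)
  (IP : forall g, I g <-> exists h : 'cV[R]_t.+1, g = (F *m h) 0 0).

Notation wj j := (widen_ord (leqnSn t) j).

Lemma MpE i j : M i j = M0 L K i j + Np p i j.
Proof. by rewrite mxE. Qed.

Lemma M0_sum (G : 'rV[R]_t.+1) (j : 'I_t) : \sum_i G 0 i * M0 L K i j =
  yvar K ^+ dE j * G 0 (wj j) - xvar K * G 0 (lift ord0 j).
Proof.
rewrite (bigD1 (wj j)) //= (bigD1 (lift ord0 j)) /=; last first.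
  by rewrite -val_eqE /= /bump /= add1n; lia.
rewrite big1 ?addr0.
  rewrite !mxE /= /bump /= add1n !eqxx [j.+1 == j]eqn_leq ltnn mulrN.
  by rewrite [G _ _ * _]mulrC [G _ _ * _]mulrC.
move=> i /andP[/eqP i1 /eqP i2]; rewrite mxE ifF ?ifF ?mulr0 //.
  by apply/eqP => e'; apply: i2; apply: val_inj; rewrite /= /bump /= add1n.
by apply/eqP => e'; apply: i1; apply: val_inj.
Qed.

(** The relation F M(p) = 0 in column [j], solved for the diagonal entry. *)
Lemma F_step (j : 'I_t) : yvar K ^+ dE j * F 0 (wj j) =
  xvar K * F 0 (lift ord0 j) - \sum_i Np p i j * F 0 i.
Proof.
have /matrixP/(_ 0 j) := FM; rewrite !mxE.
under eq_bigr => i _ do rewrite MpE mulrDr [F 0 i * Np p i j]mulrC.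
by rewrite big_split M0_sum /= => /eqP; rewrite addr_eq0 => /eqP <-; rewrite addrC subrK.
Qed.

Lemma aE_bE (j : 'I_t) : (bE j)%:Z - (dE j)%:Z = (aE (wj j))%:Z.
Proof.
have := @uE_ab _ L (wj j) j; rewrite /uE /=; have := dE_add L_mon L_rad L_lex j.
lia.
Qed.

(** By descending induction, with [F_step] in column j = i: the later entries of
    [F] have degree less than t - j in x, and N is free of x, so x F_(j+1), of
    degree t - j in x, dominates the right hand side; y^(d_j) is then cancelled. *)
Lemma F_lead_form (i : 'I_t.+1) :
  is_lead_monomial (F 0 i) (mono2 (t - i) (m i)) /\ is_form (aE i)%:Z (F 0 i).
Proof.
have [n] := ubnP (t - i); elim: n i => // n IH i; rewrite ltnS => hn.
have [e|ne] := eqVneq i ord_max.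
  rewrite e Ft /= subnn -[yvar K ^+ _]mul1r -(expr0 (xvar K)) XX_mono2.
  split; first exact: leadX.
  by rewrite (_ : aE _ = mdeg (mono2 0 (m t))) ?is_formX // mdeg2 !mono2E /aE /= subnn.
have it : (i < t)%N.
  by have := ltn_ord i; rewrite ltnS leq_eqVlt => /orP[/eqP h|//]; case/eqP: ne; apply: val_inj.
have [j ei] : exists j : 'I_t, i = wj j by exists (Ordinal it); apply: val_inj.
move: hn; rewrite ei /= => hn {it ne ei i}.
have jt := ltn_ord j.
have lift_val : lift ord0 j = j.+1 :> nat by rewrite /= /bump /= add1n.
have [lead1 form1] : is_lead_monomial (F 0 (lift ord0 j)) (mono2 (t - j.+1) (m j.+1)) /\
    is_form (aE (lift ord0 j))%:Z (F 0 (lift ord0 j)).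
  by have := IH (lift ord0 j); rewrite lift_val; apply; lia.
have IH' (i' : 'I_t.+1) : (j < i')%N -> is_lead_monomial (F 0 i') (mono2 (t - i') (m i')) /\
    is_form (aE i')%:Z (F 0 i').
  by move=> h; apply: IH; have := ltn_ord i'; lia.
have leadR : is_lead_monomial (yvar K ^+ dE j * F 0 (wj j)) (mono2 (t - j) (m j.+1)).
  rewrite F_step; apply: leadD.
    rewrite (_ : mono2 _ _ = (U_(ord0) + mono2 (t - j.+1) (m j.+1))%MM).
      exact: leadM (leadX _ _) lead1.
    by apply: mnm2P; rewrite mnmDE !mono2E mnm1E //=; lia.
  move=> m'; rewrite mcoeffN oppr_eq0 raddf_sum /= => h.
  have [i' /= hi'] : exists i' : 'I_t.+1, (Np p i' j * F 0 i')@_m' != 0.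
    apply/existsP; apply: contraR h => /existsPn h; rewrite big1 // => i' _.
    by have /negPn/eqP := h i'.
  have ji' : (j < i')%N.
    by rewrite ltnNge; apply: contraNN hi' => /Np_upper ->; rewrite mul0r mcoeff0.
  move: hi'; rewrite -mcoeff_msupp => /msuppM_le /allpairsP [[a b] /= [ha hb ->]].
  have a0 : a ord0 = 0%N by have /allP/(_ _ ha)/eqP := xfree_Np p i' j.
  have [/leadP [_ hl] _] := IH' i' ji'; have := hl b; rewrite -mcoeff_msupp => /(_ hb).
  have := ltn_ord i'; rewrite /lex_lt !mnmDE. rewrite !mono2E a0 => it'.
  by case=> [->|]; rewrite ?mono2E; lia.
have F0 : F 0 (wj j) != 0.
  by apply: contraTneq (lead_neq0 leadR) => ->; rewrite mulr0 eqxx.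
split.
  have [m0 hm0] := lead_exists F0.
  have := leadM (leadX K (mono2 0 (dE j))) hm0.
  rewrite -XX_mono2 expr0 mul1r => /lead_uniq /(_ leadR) e.
  rewrite (_ : mono2 _ _ = m0) //; apply: mnm2P; rewrite mono2E;
    move: (congr1 (fun m : 'X_{1..2} => m ord0) e) (congr1 (fun m : 'X_{1..2} => m ord_max) e);
    rewrite /= !mnmDE !mono2E; have := dE_add L_mon L_rad L_lex j; lia.
rewrite -aE_bE; apply: is_formM_cancel (is_form_yn K (dE j)) _.
  by rewrite mpolyXn (lead_neq0 (leadX _ _)).
rewrite F_step is_formD ?is_formN ?is_form_sum //; last first.
  move=> i' _; have [h|h] := leqP i' j; first by rewrite Np_upper // mul0r is_form0.
  rewrite -[(bE j)%:Z](subrK (aE i')%:Z) is_formM ?is_form_Np //.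
  by have [] := IH' i' h.
rewrite /bE -addn1 PoszD addrC is_formM //.
by have := is_formX K U_(ord0)%MM; rewrite mdeg1.
Qed.

Lemma F_lead i : is_lead_monomial (F 0 i) (mono2 (t - i) (m i)).
Proof. by have [] := F_lead_form i. Qed.

Lemma F_form i : is_form (aE i)%:Z (F 0 i).
Proof. by have [] := F_lead_form i. Qed.

(** Normal representatives modulo the columns of M(p): the entries -x below the
    diagonal allow x to be eliminated from all entries but the first. *)
Definition normal (h : 'cV[R]_t.+1) := forall i, i != ord0 -> xfree (h i 0).

Lemma normalD h h' : normal h -> normal h' -> normal (h + h').
Proof. by move=> H H' i i0; rewrite mxE xfreeD ?H ?H'. Qed.

(** In row j+1 the product of the column j of M(p) with h_(j+1) contains
    -x h_(j+1), which cancels the only term that is not free of x. *)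
Lemma normal_xmul h : normal h -> normal (xvar K *: h + M *m row' ord0 h).
Proof.
move=> H i; case: (unliftP ord0 i) => [j ->|-> /eqP //] _.
rewrite mxE mxE [(M *m _) _ _]mxE (bigD1 j) //= MpE mulrDl [row' _ _ j 0]mxE.
rewrite [M0 _ _ _ _]mxE [_ == _ :> nat]eqn_leq ifF; last by rewrite /= /bump /= add1n ltnn.
rewrite ifT ?mulNr; last by rewrite /= /bump /= add1n.
rewrite -!addrA addNKr; apply: xfreeD; first by rewrite xfreeM ?xfree_Np ?H.
apply: xfree_sum => j' ne; rewrite MpE.
rewrite [row' ord0 h _ _]mxE xfreeM ?H // xfreeD ?xfree_Np // mxE.
case: eqP => _; first exact: xfree_yn.
rewrite ifF ?xfree0 //; apply/negP => /eqP /= /eqP; rewrite /bump /= add1n eqSS => /eqP e.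
by case/eqP: ne; apply: val_inj.
Qed.

Definition normalizable (h : 'cV[R]_t.+1) := exists z, normal (h - M *m z).

Lemma normalizableD h h' : normalizable h -> normalizable h' -> normalizable (h + h').
Proof.
move=> [z H] [z' H']; exists (z + z').
by rewrite mulmxDr opprD addrACA; apply: normalD.
Qed.

Lemma normalizableZ f h : normalizable h -> normalizable (f *: h).
Proof.
elim/mpoly_ind_gen: f h => [c|s|f g Hf Hg|f g Hf Hg] h H.
- have [z Hz] := H; exists (c%:MP *: z) => i i0; rewrite -scalemxAr -scalerBr mxE.
  by rewrite xfreeM ?xfreeC ?Hz.
- have [z Hz] := H; have [->|->] := ord2E s.
    exists (xvar K *: z - row' ord0 (h - M *m z)).
    rewrite mulmxBr -scalemxAr opprB addrCA addrC -scalerBr.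
    exact: normal_xmul.
  exists (yvar K *: z) => i i0; rewrite -scalemxAr -scalerBr mxE.
  by rewrite xfreeM ?Hz // -[yvar K]expr1 xfree_yn.
- by rewrite scalerDl; apply: normalizableD; [apply: Hf|apply: Hg].
- by rewrite -scalerA; apply: Hf; apply: Hg.
Qed.

(** The normalizable vectors form a submodule, by [normal_xmul], and it contains
    the standard basis. *)
Lemma all_normalizable h : normalizable h.
Proof.
rewrite [h]matrix_sum_delta; apply: (big_ind normalizable) => [|h1 h2|i _].
- by exists 0 => i _; rewrite mulmx0 subr0 mxE xfree0.
- exact: normalizableD.
rewrite big_ord1; apply: normalizableZ; exists 0 => i' _; rewrite mulmx0 subr0 mxE.
by case: (_ && _); rewrite ?xfree0 // -mpolyC1 xfreeC.
Qed.

Lemma Fmul_E (h : 'cV[R]_t.+1) : (F *m h) 0 0 = \sum_i F 0 i * h i 0.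
Proof. by rewrite mxE. Qed.

(** The first nonzero entry of [h] determines the leading monomial: the entries
    after it are free of x, and they are multiplied by F_i of smaller degree in
    x. The result is a multiple of some x^(t-i) y^(m_i). *)
Lemma normal_lead h : normal h -> h != 0 ->
  exists n, is_lead_monomial ((F *m h) 0 0) n /\ L 'X_[n].
Proof.
move=> H /cV0Pn [i1 hi1].
have [i0 hi0 min] := @arg_minnP _ i1 (fun i => h i 0 != 0) (fun i => i : nat) hi1.
have [n hn] := lead_exists hi0; have hl := leadM (F_lead i0) hn.
exists (mono2 (t - i0) (m i0) + n)%MM; split; last first.
  rewrite [(_ + _)%MM]mono2_eta !mnmDE !mono2E.
  by apply: (E_le L_mon (leq_addr _ _) (leq_addr _ _)); apply/(mE_spec L_mon L_rad).
rewrite Fmul_E (bigD1 i0) //=; apply: leadD hl _ => m'; rewrite raddf_sum /= => hm'.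
have [i /andP [ne hi]] : exists i, (i != i0) && ((F 0 i * h i 0)@_m' != 0).
  apply/existsP; apply: contraR hm' => /existsPn hm'; rewrite big1 // => i ne.
  by have := hm' i; rewrite ne /= => /negPn /eqP.
have hi' : h i 0 != 0 by apply: contraNneq hi => ->; rewrite mulr0 mcoeff0.
have lt_i : (i0 < i)%N by rewrite ltn_neqAle min // andbT eq_sym.
move: hi; rewrite -mcoeff_msupp => /msuppM_le /allpairsP [[a b] /= [ha hb ->]].
have b0 : b ord0 = 0%N.
  have /H/allP/(_ _ hb)/eqP // : i != ord0 by rewrite -val_eqE /=; lia.
have /leadP [_ hl'] := F_lead i; have := hl' a; rewrite -mcoeff_msupp => /(_ ha).
have := ltn_ord i; rewrite /lex_lt !mnmDE !mono2E b0 => it.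
by case=> [->|]; rewrite ?mono2E; lia.
Qed.

(** The syzygies of [F] are the combinations of the columns of M(p): after
    normalization a nonzero vector is not a syzygy, by [normal_lead]. *)
Lemma syzygy (h : 'cV[R]_t.+1) : (F *m h) 0 0 = 0 -> exists z, h = M *m z.
Proof.
have [z Hz] := all_normalizable h => e; exists z; apply/eqP; rewrite -subr_eq0.
apply: contraT => /(normal_lead Hz) [n [/lead_neq0]].
by rewrite mulmxBr mulmxA FM mul0mx subr0 e eqxx.
Qed.

Lemma I_ideal : is_ideal I.
Proof.
split=> [|f g /IP [h ->] /IP [h' ->]|f g /IP [h ->]]; apply/IP.
- by exists 0; rewrite mulmx0 mxE.
- by exists (h + h'); rewrite mulmxDr [RHS]mxE.
- by exists (f *: h); rewrite -scalemxAr [RHS]mxE.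
Qed.

Lemma I_F i : I (F 0 i).
Proof. by apply/IP; exists (delta_mx i 0); rewrite -colE mxE. Qed.

Lemma I_lead f n : I f -> is_lead_monomial f n -> L 'X_[n].
Proof.
move=> /IP [h ->] hl; have [z Hz] := all_normalizable h.
have e : F *m (h - M *m z) = F *m h by rewrite mulmxBr mulmxA FM mul0mx subr0.
have [|n' [hn' Ln]] := normal_lead Hz; last by rewrite e in hn'; rewrite (lead_uniq hl hn').
by apply: contraNneq (lead_neq0 hl) => h0; rewrite -e h0 mulmx0 mxE.
Qed.

Lemma I_in_V : in_V L I.
Proof.
split; first split; first exact: I_ideal.
  move=> f /IP [h ->]; rewrite Fmul_E.
  set J := ideal_gen _; have iJ : is_ideal J by apply: ideal_genP.
  apply: ideal_sum => // i _; rewrite mulrC; have [_ _] := iJ; apply.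
  apply: ideal_gen_sub; split; first exact: I_F.
  by exists (aE i)%:Z; apply: F_form.
move=> f; split.
  apply: ideal_gen_mono => g [f' [n [If f0 hl ->]]]; apply: ideal_gen_sub; exists n.
  by split=> //; apply: I_lead hl.
apply: ideal_gen_mono => g [n [Ln ->]].
set J := ideal_gen _; have iJ : is_ideal J by apply: ideal_genP.
have JF i : J 'X_[mono2 (t - i) (m i)].
  case: (leqP i t) => [it|it]; last first.
    have JF0 : J 'X_[mono2 (t - t) (m t)].
      apply: ideal_gen_sub; exists (F 0 ord_max), (mono2 (t - t) (m t)).
      by split=> //; [apply: I_F | apply: lead_neq0 (F_lead _) | apply: (F_lead ord_max)].
    suff -> : mono2 (t - i) (m i) = mono2 (t - t) (m t) by [].
    by rewrite /mE (_ : t - i = t - t)%N //; lia.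
  have := @F_lead (Ordinal (it : (i < t.+1)%N)) => hl.
  apply: ideal_gen_sub; eexists; eexists; split; [apply: I_F|apply: lead_neq0 hl|exact: hl|by []].
have [_ _ JM] := iJ.
move: Ln; rewrite [n]mono2_eta => /(E_iff L_mon L_rad) [h|[i it [e h]]].
  rewrite (@mpolyX_dvd K (mono2 t (m 0))) ?mono2E //.
    by apply: JM; have := JF 0%N; rewrite subn0.
  by rewrite (mE0 L_mon L_rad).
rewrite (@mpolyX_dvd K (mono2 (t - i) (m i))) ?mono2E ?e //; exact: JM.
Qed.

(** * Minimal generators of each degree *)

(** The product of the ideals (x, y) and [I]. *)
Definition mI (g : R) := exists w0 w1, [/\ I w0, I w1 & g = w0 * xvar K + w1 * yvar K].

(** Polynomials without constant term lie in (x, y). *)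
Lemma mI_intro (h : 'cV[R]_t.+1) : (forall i, (h i 0)@_0%MM = 0) -> mI ((F *m h) 0 0).
Proof.
move=> h0; have dec i : exists v : 'rV[R]_2, h i 0 = v 0 ord0 * xvar K + v 0 ord_max * yvar K.
  have [|v /matrixP/(_ 0 0)] := proj1 (koszul_exact0 (h i 0)).
    exact: ideal_xy_const0.
  rewrite !mxE eqxx mulr1n big_ord_recl big_ord1 !mxE (_ : lift _ _ = ord_max); last exact: val_inj.
  by move=> ->; exists v.
pose v i := epsilon (inhabits 0) (fun v : 'rV[R]_2 => h i 0 = v 0 ord0 * xvar K + v 0 ord_max * yvar K).
have hv i : h i 0 = v i 0 ord0 * xvar K + v i 0 ord_max * yvar K := epsilon_spec (inhabits 0) _ (dec i).
exists ((F *m \col_i v i 0 ord0) 0 0), ((F *m \col_i v i 0 ord_max) 0 0).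
split; [by apply/IP; eexists|by apply/IP; eexists|].
rewrite !Fmul_E !mulr_suml -big_split; apply: eq_bigr => i _ /=.
by rewrite hv !mxE mulrDr !mulrA.
Qed.

Lemma I_hcomp d f : I f -> I (hcomp d f).
Proof.
move=> /IP [h ->]; apply/IP; exists (\col_i hcomp (d - (aE i)%:Z) (h i 0)).
rewrite !Fmul_E hcomp_sum; apply: eq_bigr => i _.
by rewrite mxE (hcompM _ _ (F_form i)).
Qed.

(** Replacing [w0] and [w1] by their components of degree j - 1, which stay in
    [I], turns membership in (x, y) I into a homogeneous boundary. *)
Lemma mI_boundary (j : int) (v : 'rV[R]_('C(2, 0))) :
  tor_boundary I (i := 0) j v <-> mI (v 0 ord0) /\ is_form j (v 0 ord0).
Proof.
have E (w : 'rV[R]_('C(2, 1))) :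
    (w *m koszul K 1) 0 ord0 = w 0 ord0 * xvar K + w 0 ord_max * yvar K.
  by rewrite mxE big_ord_recl big_ord1 !mxE (_ : lift _ _ = ord_max) //; apply: val_inj.
have fx : is_form 1 (xvar K) by have := is_formX K U_(ord0)%MM; rewrite mdeg1.
have fy : is_form 1 (yvar K) by have := is_formX K U_(ord_max)%MM; rewrite mdeg1.
split=> [[w [wI ->]]|[[w0 [w1 [I0 I1 e]]] fv]].
  rewrite E; split.
    by exists (w 0 ord0), (w 0 ord_max); split=> //; [have [] := wI ord0|have [] := wI ord_max].
  by rewrite is_formD // -[j](subrK 1) is_formM //; [have [] := wI ord0|have [] := wI ord_max].
exists (\row_(s < 2) hcomp (j - 1) (if s == ord0 then w0 else w1)); split.
  by move=> s; rewrite mxE is_form_hcomp; split=> //; apply: I_hcomp; case: ifP.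
apply/matrixP => a b; rewrite (ord1 a) (ord1 b) E !mxE /=.
by rewrite -(hcomp_id fv) e hcompD ![_ * 'X__]mulrC !(hcompM _ _ fx, hcompM _ _ fy).
Qed.

Definition Mconst (j : int) : 'M[K]_(#|wE L j|, #|vE L j|) :=
  \matrix_(a, b) (Mp p (enum_val a) (enum_val b))@_0%MM.

Section Degree.
Variable j : int.
Notation ew := (fun a : 'I_#|wE L j| => enum_val a).
Notation ev := (fun b : 'I_#|vE L j| => enum_val b).
Notation A := (Mconst j).

(** A linear combination of the generators of degree [j], as a vector of
    coefficients for [F]. *)
Definition wvec (c : 'rV[K]_#|wE L j|) : 'cV[R]_t.+1 :=
  \sum_a (c 0 a)%:MP *: delta_mx (ew a) 0.

Lemma wE_aE a : (aE (ew a))%:Z = j.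
Proof. by have := enum_valP a; rewrite inE => /eqP. Qed.

Lemma Fmul_wvec c : (F *m wvec c) 0 0 = \sum_a (c 0 a)%:MP * F 0 (ew a).
Proof.
rewrite mulmx_sumr summxE; apply: eq_bigr => a _.
by rewrite -scalemxAr mxE -colE mxE.
Qed.

Lemma wvecE c i : (wvec c i 0)@_0%MM = \sum_(a | ew a == i) c 0 a.
Proof.
rewrite summxE raddf_sum [RHS]big_mkcond /=; apply: eq_bigr => a _.
rewrite !mxE eqxx andbT mcoeffCM eq_sym; case: eqP => _; rewrite ?mulr0n ?mcoeff0 ?mulr0 //.
by rewrite mulr1n mcoeff1 eqxx mulr1.
Qed.

Lemma wvec_in c a : (wvec c (ew a) 0)@_0%MM = c 0 a.
Proof.
by rewrite wvecE (eq_bigl (pred1 a)) ?big_pred1_eq // => a'; rewrite /= (inj_eq enum_val_inj).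
Qed.

Lemma wvec_out c i : i \notin wE L j -> (wvec c i 0)@_0%MM = 0.
Proof.
by move=> h; rewrite wvecE big_pred0 // => a; apply: contraNF h => /eqP <-; apply: enum_valP.
Qed.

(** By [Mp_const], a row of degree [j] has constants only in columns of degree [j]. *)
Lemma Mp_const_sum (i : 'I_t.+1) (z : 'I_t -> K) : i \in wE L j ->
  \sum_l (M i l)@_0%MM * z l = \sum_(b < #|vE L j|) (M i (ev b))@_0%MM * z (ev b).
Proof.
move=> hi; rewrite (bigID (mem (vE L j))) /= [X in _ + X]big1 ?addr0.
  by rewrite big_enum_val.
move=> l hl; rewrite (Mp_const L_mon L_rad L_lex) ifF ?mul0r //.
apply: contraNF hl => /eqP e; move: hi; rewrite !inE e; exact.
Qed.

(** Nakayama: I/(x, y)I is the cokernel of the matrix of constant terms of M(p).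
    A combination of generators in (x, y)I is the constant part of a syzygy,
    that is, by [syzygy], of a combination of columns; conversely each column of
    M(p) is a relation, which leaves its constant part in (x, y)I. *)
Lemma wvec_mI c : mI ((F *m wvec c) 0 0) <-> (c <= A^T)%MS.
Proof.
split=> [[w0 [w1 [/IP [h0 ->] /IP [h1 ->] e]]]|/submxP [z ec]].
  have [|z hz] := @syzygy (wvec c - (xvar K *: h0 + yvar K *: h1)).
    by rewrite mulmxBr mulmxDr -!scalemxAr mxBE mxDE !mxZE e ![_ * 'X__]mulrC subrr.
  apply/submxP; exists (\row_b (z (ev b) 0)@_0%MM); apply/rowP => a.
  have /(congr1 (mcoeff 0%MM)) := congr1 (fun v : 'cV[R]_t.+1 => v (ew a) 0) hz.
  rewrite /= mxBE mxDE !mxZE mcoeffB wvec_in mcoeffD !(rmorphM (mcoeff 0%MM)) /= !mcoeffX !mnm1_eq0 !mul0r addr0 subr0.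
  move=> ->; rewrite [(M *m z) _ _]mxE raddf_sum /=.
  under eq_bigr do rewrite (rmorphM (mcoeff 0%MM)) /=.
  rewrite (@Mp_const_sum _ (fun l => (z l 0)@_0%MM) (enum_valP a)) mxE.
  by apply: eq_bigr => b _; rewrite !mxE mulrC.
pose z' : 'cV[R]_t := \sum_b (z 0 b)%:MP *: delta_mx (ev b) 0.
have z'E l : (z' l 0)@_0%MM = \sum_(b | ev b == l) z 0 b.
  rewrite summxE raddf_sum [RHS]big_mkcond /=; apply: eq_bigr => b _.
  rewrite !mxE eqxx andbT mcoeffCM eq_sym; case: eqP => _; rewrite ?mulr0n ?mcoeff0 ?mulr0 //.
  by rewrite mulr1n mcoeff1 eqxx mulr1.
rewrite -[wvec c](subrK (M *m z')) mulmxDr mulmxA FM mul0mx addr0; apply: mI_intro => i.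
rewrite mxBE mcoeffB [(M *m z') _ _]mxE raddf_sum /=.
under eq_bigr do rewrite (rmorphM (mcoeff 0%MM)) /= z'E.
have [hi|hi] := boolP (i \in wE L j).
  rewrite (@Mp_const_sum _ (fun l => \sum_(b | ev b == l) z 0 b) hi) /=.
  have -> : i = ew (enum_rank_in hi i) by rewrite /= enum_rankK_in.
  rewrite wvec_in ec mxE; apply/eqP; rewrite subr_eq0; apply/eqP; apply: eq_bigr => b _.
  rewrite !mxE mulrC (eq_bigl (pred1 b)) ?big_pred1_eq // => b'.
  by rewrite /= (inj_eq enum_val_inj).
rewrite wvec_out // add0r big1 ?oppr0 // => l _.
have [hl|hl] := boolP (l \in vE L j); last first.
  by rewrite big_pred0 ?mulr0 // => b; apply: contraNF hl => /eqP <-; apply: enum_valP.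
rewrite (Mp_const L_mon L_rad L_lex) ifF ?mul0r //.
by apply: contraNF hi => /eqP e; move: hl; rewrite !inE e.
Qed.

(** A form of degree [j] in I is F h with h_i of degree j - a_i, and only the rows
    with a_i = j leave a constant coefficient. *)
Lemma wvec_span g : I g -> is_form j g -> exists c, mI (g - (F *m wvec c) 0 0).
Proof.
move=> /IP [h ->] fg; pose h' : 'cV[R]_t.+1 := \col_i hcomp (j - (aE i)%:Z) (h i 0).
have -> : (F *m h) 0 0 = (F *m h') 0 0.
  rewrite -(hcomp_id fg) !Fmul_E hcomp_sum; apply: eq_bigr => i _.
  by rewrite mxE (hcompM _ _ (F_form i)).
exists (\row_a (h' (ew a) 0)@_0%MM); rewrite -mxBE -mulmxBr; apply: mI_intro => i.
rewrite mxBE mcoeffB; have [hi|hi] := boolP (i \in wE L j).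
  have -> : i = ew (enum_rank_in hi i) by rewrite /= enum_rankK_in.
  by rewrite wvec_in [in X in _ - X]mxE subrr.
rewrite wvec_out // subr0 mxE mcoeff_hcomp mdeg0; case: eqP => // e.
by move: hi; rewrite inE -(subr_eq0 _ j) -opprB -e oppr0 eqxx.
Qed.

Lemma betti0_quotient_dim :
  quotient_dim (tor_cycle I (i := 0) j) (tor_boundary I (i := 0) j)
    (#|wE L j| - \rank (Mconst j))%N.
Proof.
pose e (a : 'I_#|wE L j|) : 'rV[R]_('C(2, 0)) := (F 0 (ew a))%:M.
have sum_e (c : 'I_#|wE L j| -> K) :
    (\sum_a (c a)%:MP *: e a) 0 ord0 = (F *m wvec (\row_a c a)) 0 0.
  rewrite Fmul_wvec summxE; apply: eq_bigr => a _.
  by rewrite mxZE [in RHS]mxE [(_%:M) _ _]mxE eqxx mulr1n.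
have form_e a : is_form j (F 0 (ew a)) by rewrite -[X in is_form X _](wE_aE a); apply: F_form.
have form_sum c : is_form j ((F *m wvec c) 0 0).
  by rewrite Fmul_wvec is_form_sum // => a _; apply: is_formZ.
rewrite -mxrank_tr; apply: (quotient_dim_coker (e := e)).
- exact: tor_boundaryD I_ideal.
- exact: tor_cycleZ I_ideal.
- exact: tor_cycleD I_ideal.
- exact: tor_cycle0 I_ideal.
- move=> a; split; last by rewrite mulmx0.
  move=> s; rewrite subr0 (ord1 s) mxE eqxx mulr1n form_e; split=> //; exact: I_F.
- move=> c; rewrite mI_boundary sum_e form_sum wvec_mI; split=> [[]|] //.
- move=> v [cv _]; have [Iv fv] := cv ord0; rewrite subr0 in fv.
  have [c hc] := wvec_span Iv fv; exists (fun a => c 0 a).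
  apply/mI_boundary; rewrite mxBE sum_e (_ : \row_a c 0 a = c); last by apply/rowP => a; rewrite mxE.
  by split=> //; rewrite is_formD // is_formN.
Qed.

Lemma betti0_E : betti I 0 j = (#|wE L j| - \rank (Mconst j))%N.
Proof. exact: (bettiE I_ideal betti0_quotient_dim). Qed.

End Degree.

End HilbertBurch.

(** * The ideals I_p and L *)

Section Instances.
Variables (k : fieldType) (L : {mpoly k[2]} -> Prop).
Hypothesis L_rad : forall f, radical L f <-> ideal_xy f.
Hypothesis L_lex : lex_segment_ideal L.
Let L_mon : monomial_ideal L := proj1 L_lex.

Local Notation t := (tE L).
Local Notation m := (mE L).

Section Ip.
Variables (K : fieldType) (p : 'I_(nE L) -> K).
Notation R := {mpoly K[2]}.
Notation M := (Mp p).

(** The sign (-1)^t makes the last entry equal to y^(m_t). *)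
Definition minors : 'rV[R]_t.+1 := \row_i ((-1) ^+ (t + i) * \det (row' i M : 'M_t)).

(** Laplace expansion of the determinant of M(p) with its column [j] repeated in
    front. *)
Lemma minors_mul : minors *m M = 0.
Proof.
apply/rowP => j; rewrite [RHS]mxE [LHS]mxE.
pose B : 'M[R]_t.+1 := \matrix_(i, l) (if unlift ord0 l is Some l' then M i l' else M i j).
have BE i l : B i l = if unlift ord0 l is Some l' then M i l' else M i j by rewrite mxE.
have detB : \det B = 0.
  rewrite -det_tr; apply: (determinant_alternate (neq_lift ord0 j)) => i.
  by rewrite [LHS]mxE [RHS]mxE !BE unlift_none liftK.
apply: (@mulrI _ ((-1) ^+ t)); first by rewrite unitrX ?unitrN1.
rewrite mulr0; transitivity (\det B) => //; rewrite (expand_det_col _ ord0) mulr_sumr.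
apply: eq_bigr => i _.
rewrite BE unlift_none mxE /cofactor addn0 [row' i (col' ord0 B)](_ : _ = row' i M).
  by rewrite exprD !mulrA -expr2 -exprM mulnC exprM sqrrN expr1n expr1n mul1r mulrC mulrA.
by apply/matrixP => a b; rewrite [LHS]mxE [LHS]mxE BE liftK [RHS]mxE.
Qed.

(** Without its last row, M(p) is lower triangular with diagonal entries
    y^(d_j), and the d_j add up to m_t. *)
Lemma minors_last : minors 0 ord_max = yvar K ^+ m t.
Proof.
rewrite mxE addnn -mul2n exprM sqrrN expr1n expr1n mul1r det_trig; last first.
  apply/is_trig_mxP => i j ij; rewrite mxE MpE Np_upper ?addr0 ?lift_max 1?ltnW // mxE lift_max.
  by rewrite !ifF //; lia.
under eq_bigr => i _ do rewrite mxE MpE Np_upper ?lift_max // addr0 mxE lift_max eqxx.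
have H n (h : (n <= t)%N) : \prod_(i < n) yvar K ^+ (m i.+1 - m i)%N = yvar K ^+ m n.
  elim: n h => [|n IH] h; first by rewrite big_ord0 (mE0 L_mon L_rad) expr0.
  rewrite big_ord_recr /= IH ?(ltnW h) // -exprD subnKC // ltnW //.
  exact: (mE_lt L_mon L_rad L_lex).
exact: H.
Qed.

Lemma IpP g : Ip p g <-> exists h : 'cV[R]_t.+1, g = (minors *m h) 0 0.
Proof.
split=> [/(_ (fun g => exists h : 'cV[R]_t.+1, g = (minors *m h) 0 0)) Ig|[h ->]].
  apply: Ig; first split=> [|f f' [h ->] [h' ->]|f f' [h ->]].
  - by exists 0; rewrite mulmx0 mxE.
  - by exists (h + h'); rewrite mulmxDr mxDE.
  - by exists (f *: h); rewrite -scalemxAr mxZE.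
  move=> f [i ->]; exists (((-1) ^+ (t + i)) *: delta_mx i 0).
  by rewrite -scalemxAr mxZE -colE !mxE mulrA -expr2 -exprM mulnC exprM sqrrN expr1n expr1n mul1r.
rewrite mxE; apply: ideal_sum => [|i _]; first exact: ideal_genP.
rewrite mxE mulrAC; have [_ _ IM] := ideal_genP (fun g => exists i : 'I_t.+1, g = \det (row' i M : 'M_t)).
by apply: IM; apply: ideal_gen_sub; exists i.
Qed.

Lemma Ip_in_V : in_V L (Ip p).
Proof. exact: (I_in_V L_rad L_lex minors_mul minors_last IpP). Qed.

Lemma betti0_Ip j : betti (Ip p) 0 j = (#|wE L j| - \rank (Mconst p j))%N.
Proof. exact: (betti0_E L_rad L_lex minors_mul minors_last IpP). Qed.

End Ip.

(** L is presented by M(0), with the monomials x^(t-i) y^(m_i) as generators, and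
    all the constants of M(0) vanish. *)
Lemma betti0_L j : betti L 0 j = #|wE L j|.
Proof.
pose p : 'I_(nE L) -> k := fun _ => 0.
have Np0 i j' : Np p i j' = 0 by rewrite mxE; case: pickP => // s _; rewrite mpolyC0 mul0r.
pose F : 'rV[{mpoly k[2]}]_t.+1 := \row_i (xvar k ^+ (t - i) * yvar k ^+ m i).
have FM : F *m Mp p = 0.
  apply/rowP => l; rewrite [RHS]mxE [LHS]mxE; under eq_bigr do rewrite MpE Np0 addr0.
  rewrite M0_sum !mxE /= /bump /= add1n mulrCA -exprD addnC (dE_add L_mon L_rad L_lex).
  by rewrite mulrA -exprS -subnSK // subrr.
have Ft : F 0 ord_max = yvar k ^+ m t by rewrite mxE /= subnn expr0 mul1r.
have [iL _] := L_mon; have [L0 LD LM] := iL.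
have FP g : L g <-> exists h : 'cV[{mpoly k[2]}]_t.+1, g = (F *m h) 0 0.
  split=> [Lg|[h ->]]; last first.
    rewrite mxE; apply: ideal_sum => // i _; rewrite mxE mulrC; apply: LM.
    by rewrite XX_mono2; apply/(mE_spec L_mon L_rad).
  pose J f := exists h : 'cV[{mpoly k[2]}]_t.+1, f = (F *m h) 0 0.
  have iJ : is_ideal J.
    split=> [|f f' [h ->] [h' ->]|f f' [h ->]].
    - by exists 0; rewrite mulmx0 mxE.
    - by exists (h + h'); rewrite mulmxDr mxDE.
    - by exists (f *: h); rewrite -scalemxAr mxZE.
  rewrite [g]mpolyE; apply: (ideal_sum_seq iJ) => n; rewrite mcoeff_msupp => hn.
  have [_ _ JM] := iJ; rewrite -mul_mpolyC; apply: (JM).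
  have /(monomial_idealP L_mon)/(_ n hn) := Lg; rewrite [n]mono2_eta.
  have JF (i : 'I_t.+1) : J 'X_[mono2 (t - i) (m i)].
    by exists (delta_mx i 0); rewrite -colE !mxE XX_mono2.
  move=> /(E_iff L_mon L_rad) [h|[i it [e h]]].
    rewrite (@mpolyX_dvd k (mono2 (t - @ord0 t) (m (@ord0 t)))) ?mono2E /= ?subn0 //.
      by apply: JM; have := JF ord0; rewrite /= subn0.
    by rewrite (mE0 L_mon L_rad).
  rewrite (@mpolyX_dvd k (mono2 (t - i) (m i))) ?mono2E ?e //.
  by apply: JM; apply: (JF (Ordinal (it : (i < t.+1)%N))).
rewrite (betti0_E L_rad L_lex FM Ft FP) (_ : Mconst p j = 0) ?mxrank0 ?subn0 //.
apply/matrixP => a b; rewrite [LHS]mxE [RHS]mxE (Mp_const L_mon L_rad L_lex) Np0 mcoeff0.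
by case: ifP.
Qed.

(** * The socle of R/L *)

Lemma koszul21 (w : 'rV[{mpoly k[2]}]_1) :
  w *m koszul k 2 = \row_(s < 2) (if s == ord0 then w 0 0 * yvar k else - (w 0 0 * xvar k)).
Proof.
apply/rowP => s; rewrite !mxE big_ord1 !mxE; case: ifP => //; by rewrite mulrN.
Qed.

(** The corner of the staircase of L between two consecutive generators. *)
Definition socle_mnm (l : 'I_t) : 'X_{1..2} := mono2 (t - l.+1) (m l.+1).-1.

Lemma mE_pred (l : 'I_t) : (m l.+1).-1.+1 = m l.+1.
Proof. by rewrite prednK //; apply: leq_ltn_trans (mE_lt L_mon L_rad L_lex (ltn_ord l)). Qed.

Lemma socle_mnm_inj : injective socle_mnm.
Proof.
move=> l l' /(congr1 (fun n : 'X_{1..2} => n ord0)); rewrite !mono2E => e; apply: val_inj => /=.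
have := ltn_ord l; have := ltn_ord l'; lia.
Qed.

Lemma socle_mnm_deg (l : 'I_t) : (mdeg (socle_mnm l)).+2 = bE l.
Proof.
rewrite mdeg2 !mono2E bE_val; have := mE_pred l; have := ltn_ord l; lia.
Qed.

Lemma socle_mnm_notin (l : 'I_t) : ~ L 'X_[socle_mnm l].
Proof. by move/(mE_spec L_mon L_rad); rewrite -[X in (X <= _)%N]mE_pred ltnn. Qed.

Lemma socle_mnm_mul (l : 'I_t) i : L ('X_[socle_mnm l] * 'X_i).
Proof.
rewrite -mpolyXD [(_ + _)%MM]mono2_eta; have lt := ltn_ord l.
have [->|->] := ord2E i; rewrite !mnmDE !mono2E !mnm1E /=.
  rewrite addn0 (_ : t - l.+1 + 1 = t - l)%N; last by lia.
  apply/(mE_spec L_mon L_rad); rewrite -ltnS mE_pred; exact: mE_lt.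
rewrite addn0; apply/(mE_spec L_mon L_rad); have := mE_pred l; lia.
Qed.

Lemma socle_mnmP n : L ('X_[n] * xvar k) -> L ('X_[n] * yvar k) -> ~ L 'X_[n] ->
  exists l, n = socle_mnm l.
Proof.
rewrite -!mpolyXD [n]mono2_eta [X in L 'X_[X] -> _]mono2_eta [X in _ -> L 'X_[X] -> _]mono2_eta.
rewrite !mnmDE !mono2E !mnm1E /= !addn0 !addn1.
set a := n ord0; set b := n ord_max => hx hy hn.
have at_ : (a < t)%N.
  by rewrite ltnNge; apply/negP => h; apply: hn; apply/(E_iff L_mon L_rad); left.
have lt : (t - a.+1 < t)%N by lia.
exists (Ordinal lt); rewrite /socle_mnm /= (_ : t - (t - a.+1).+1 = a)%N; last by lia.
congr mono2.
have ea : (t - (t - a) = a)%N by lia.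
have ea1 : (t - (t - a.+1) = a.+1)%N by lia.
have e' : ((t - a.+1).+1 = t - a)%N by lia.
have h1 : (m (t - a) <= b.+1)%N by apply: (proj1 (mE_spec L_mon L_rad _ _)); rewrite ea.
have h2 : ~ (m (t - a) <= b)%N by move/(mE_spec L_mon L_rad); rewrite ea.
rewrite e'; lia.
Qed.

Lemma tor_boundary1 j (h : {mpoly k[2]}) :
  tor_boundary L (i := 1) j ((h%:M : 'M_1) *m koszul k 2) -> L h.
Proof.
move=> [w [wL e]]; suff -> : h = w 0 0 by have [] := wL 0.
apply: (mulIf (x := yvar k)); first exact: (lead_neq0 (leadX k U_(ord_max)%MM)).
move: e; rewrite !koszul21 => /rowP/(_ ord0); by rewrite !mxE /= ?mulr1n.
Qed.

(** A cycle is (y h, -x h), by exactness of the Koszul complex, with h in the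
    ideal L : (x, y); it is a boundary exactly when h is in L. So the homology is the
    socle of R/L in degree j - 2, with basis the monomials [socle_mnm]. *)
Lemma betti1_quotient_dim j :
  quotient_dim (tor_cycle L (i := 1) j) (tor_boundary L (i := 1) j) #|vE L j|.
Proof.
pose s (b : 'I_#|vE L j|) : {mpoly k[2]} := 'X_[socle_mnm (enum_val b)].
have s_form b : is_form (j - 2) (s b).
  rewrite (_ : j - 2 = mdeg (socle_mnm (enum_val b))) ?is_formX //.
  have := socle_mnm_deg (enum_val b); have := enum_valP b; rewrite inE => /eqP; lia.
have sumE (c : 'I_#|vE L j| -> k) :
    \sum_b (c b)%:MP *: (((s b)%:M : 'M_1) *m koszul k 2) =
    ((\sum_b (c b)%:MP * s b)%:M : 'M_1) *m koszul k 2.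
  rewrite raddf_sum mulmx_suml; apply: eq_bigr => b _.
  by rewrite scalemxAl scale_scalar_mx.
have s_coeff (c : 'I_#|vE L j| -> k) b :
    (\sum_b (c b)%:MP * s b)@_(socle_mnm (enum_val b)) = c b.
  rewrite raddf_sum (bigD1 b) //= mcoeffCM mcoeffX eqxx mulr1 big1 ?addr0 // => b' ne.
  rewrite mcoeffCM mcoeffX; case: eqP => [/socle_mnm_inj/enum_val_inj e|]; last by rewrite mulr0.
  by rewrite e eqxx in ne.
have fX i : is_form 1 ('X_i : {mpoly k[2]}) by have := is_formX k U_(i)%MM; rewrite mdeg1.
exists (fun b => ((s b)%:M : 'M_1) *m koszul k 2); split.
- move=> b; split.
    have f1 i : is_form (j - 1) (s b * 'X_i).
      by rewrite (_ : j - 1 = j - 2 + 1) ?is_formM //; lia.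
    move=> i; rewrite koszul21 !mxE eqxx mulr1n; case: ifP => _; first by split=> //; apply: socle_mnm_mul.
    rewrite is_formN //; split=> //; have [[_ _ LM] _] := L_mon; rewrite -mulN1r; apply: LM.
    exact: socle_mnm_mul.
  rewrite -mulmxA [koszul k 2 *m _](_ : _ = 0) ?mulmx0 //.
  apply/matrixP => a b'; rewrite !mxE big_ord_recl big_ord1 !mxE /=.
  rewrite (_ : lift _ _ = ord_max); last exact: val_inj.
  by rewrite mulrC mulNr subrr.
- move=> c; rewrite sumE => /tor_boundary1 /(monomial_idealP L_mon) h b.
  apply/eqP; apply: contraT => cb; case: (@socle_mnm_notin (enum_val b)); apply: h.
  by rewrite s_coeff.
- move=> v [cv /koszul_exact1 [w ew]]; set h := w 0 0.
  have w_h : w = h%:M by apply/matrixP => a b; rewrite (ord1 a) (ord1 b) mxE eqxx mulr1n.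
  rewrite {}w_h in ew.
  have [hy fy] : L (h * yvar k) /\ is_form (j - 1) (h * yvar k).
    by have := cv ord0; rewrite ew koszul21 !mxE !eqxx mulr1n.
  have [hx _] : L (- (h * xvar k)) /\ is_form (j - 1) (- (h * xvar k)).
    by have := cv ord_max; rewrite ew koszul21 !mxE !eqxx mulr1n.
  have fh : is_form (j - 2) h.
    rewrite (_ : j - 2 = j - 1 - 1); last by lia.
    apply: (is_formM_cancel _ (fX ord_max)); last by rewrite mulrC.
    exact: (lead_neq0 (leadX k U_(ord_max)%MM)).
  exists (fun b => h@_(socle_mnm (enum_val b))).
  rewrite sumE ew -mulmxBl -raddfB /=; set h' := h - _.
  have fh' : is_form (j - 2) h'.
    by rewrite is_formD ?is_formN ?is_form_sum // => b _; apply: is_formZ.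
  exists h'%:M; split=> // i; rewrite (ord1 i) mxE eqxx mulr1n; split=> //.
  apply/(monomial_idealP L_mon) => n hn.
  apply: NNPP => nL.
  have nE (i0 : 'I_2) f : L (f * 'X_i0) -> f@_n != 0 -> L ('X_[n] * 'X_i0).
    move=> /(monomial_idealP L_mon) h0 fn; rewrite -mpolyXD; apply: h0; by rewrite addmC mcoeffMX.
  have hn0 : h@_n != 0 \/ exists b : 'I_#|vE L j|, n = socle_mnm (enum_val b).
    have [e|e] := eqVneq h@_n 0; [right|by left].
    have [b hb] : exists b, ((h@_(socle_mnm (enum_val b)))%:MP * s b)@_n != 0.
      apply/existsP; apply: contraR hn => /existsPn hn.
      rewrite mcoeffB e sub0r oppr_eq0 raddf_sum big1 //= => b _.
      by have /negPn/eqP := hn b.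
    exists b; apply/esym/eqP; apply: contraNT hb => ne.
    by rewrite mcoeffCM mcoeffX (negbTE ne) mulr0.
  have no_b (b : 'I_#|vE L j|) : n <> socle_mnm (enum_val b).
    by move=> e; move: hn; rewrite e mcoeffB s_coeff subrr eqxx.
  case: hn0 => [hn0|[b /no_b //]].
  have [l el] : exists l, n = socle_mnm l.
    apply: socle_mnmP => //; apply: nE hn0 => //.
    by have [[_ _ LM] _] := L_mon; have := LM (-1) _ hx; rewrite mulN1r opprK.
  have lv : l \in vE L j.
    rewrite inE -socle_mnm_deg -el; move/is_formP/(_ _ hn0): fh; lia.
  by apply: (no_b (enum_rank_in lv l)); rewrite enum_rankK_in.
Qed.

Lemma betti1_L j : betti L 1 j = #|vE L j|.
Proof. exact: (bettiE (proj1 L_mon) (betti1_quotient_dim j)). Qed.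

(** * The matrix M(p)_j *)

Section Coordinates.
Variable j : int.

Lemma block_SE (ab : 'I_#|wE L j| * 'I_#|vE L j|) : (enum_val ab.1, enum_val ab.2) \in SE L.
Proof.
apply: (S_degree0 L_mon L_rad L_lex).
have := enum_valP ab.1; have := enum_valP ab.2; rewrite !inE => /eqP e /eqP e'.
by apply/eqP; rewrite -eqz_nat e e'.
Qed.

Definition block_coord (ab : 'I_#|wE L j| * 'I_#|vE L j|) : 'I_(nE L) :=
  enum_rank_in (block_SE ab) (enum_val ab.1, enum_val ab.2).

Lemma block_coordK ab : enum_val (block_coord ab) = (enum_val ab.1, enum_val ab.2).
Proof. by rewrite /block_coord enum_rankK_in ?block_SE. Qed.

Lemma block_coord_inj : injective block_coord.
Proof.
move=> [a b] [a' b'] /(congr1 enum_val); rewrite !block_coordK => -[].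
by move=> /enum_val_inj -> /enum_val_inj ->.
Qed.

(** Rows and columns of degree [j] only meet in entries of degree 0, away from the
    entries of M_0(L). *)
Lemma MpjE (K : fieldType) (p : 'I_(nE L) -> K) :
  Mpj p j = \matrix_(a, b) (p (block_coord (a, b)))%:MP.
Proof.
apply/matrixP => a b; rewrite [LHS]mxE [RHS]mxE MpE.
have eab : bE (enum_val b) = aE (enum_val a).
  have := enum_valP a; have := enum_valP b; rewrite !inE => /eqP e /eqP e'.
  by apply/eqP; rewrite -eqz_nat e e'.
rewrite (Np_const p (block_coordK (a, b)) eab) /=.
have := block_SE (a, b); rewrite inE /= => /andP [lt_ba _]; rewrite mxE.
have /negbTE -> : nat_of_ord (enum_val a) != enum_val b by rewrite neq_ltn lt_ba orbT.
case: eqP => [e|_]; last by rewrite add0r.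
by have := uE_ab (enum_val a) (enum_val b); rewrite eab subrr /uE e subrr add0r -addn1 PoszD addrAC subrr.
Qed.

Definition block (K : fieldType) (p : 'I_(nE L) -> K) : 'M[K]_(#|wE L j|, #|vE L j|) :=
  \matrix_(a, b) p (block_coord (a, b)).

Lemma rank_Mpj (K : fieldType) (p : 'I_(nE L) -> K) : rank_dom (Mpj p j) = \rank (block p).
Proof.
rewrite /rank_dom MpjE -(mxrank_map (@tofrac {mpoly K[2]} \o @mpolyC 2 K)); congr (\rank _).
by apply/matrixP => a b; rewrite !mxE.
Qed.

Lemma betti0_block (K : fieldType) (p : 'I_(nE L) -> K) :
  betti (Ip p) 0 j = (#|wE L j| - \rank (block p))%N.
Proof.
rewrite betti0_Ip; congr (_ - \rank _)%N; apply/matrixP => a b.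
have /matrixP/(_ a b) := MpjE p; rewrite [LHS]mxE !mxE => ->.
by rewrite mcoeffC eqxx mulr1.
Qed.

End Coordinates.

End Instances.

(** * Growth and chains of prime ideals *)

Section Growth.
Variables (k : fieldType) (n : nat).
Notation R := {mpoly k[n]}.
Implicit Types P : R -> Prop.

(** The Gelfand-Kirillov dimension of the quotient by [P] is at least [N], in an
    explicit form: d^N independent elements of degree at most a multiple of d. *)
Definition growth P (N : nat) := exists e, forall d, exists (A : finType) (g : A -> R),
  [/\ #|A| = (d ^ N)%N, forall a, (msize (g a) <= (e * d).+1)%N
    & forall c : A -> k, P (\sum_a (c a)%:MP * g a) -> forall a, c a = 0].

Lemma card_bmultinom b : (#|{: 'X_{1..n < b}}| <= b ^ n)%N.
Proof.
rewrite -[n in X in (_ <= X)%N]card_ord -[b in X in (_ <= X ^ _)%N]card_ord -card_ffun.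
have lt (m : 'X_{1..n < b}) i : (m i < b)%N.
  by apply: leq_ltn_trans (bmdeg m); rewrite mdegE (bigD1 i) //= leq_addr.
apply: (@leq_card _ _ (fun m => [ffun i => Ordinal (lt m i)])) => m m' /ffunP e.
apply/val_inj/mnmP => i; by have /(congr1 val) := e i; rewrite !ffunE.
Qed.

(** The polynomials of degree at most e d span a space of dimension at most
    (e d + 1)^n, which d^N exceeds for large d if N > n. *)
Lemma growth_le P N : P 0 -> growth P N -> (N <= n)%N.
Proof.
move=> P0 [e he]; rewrite leqNgt; apply/negP => lt_nN.
(* (e d + 1)^n <= (e + 1)^n d^n < d^(n+1) holds as soon as (e + 1)^n < d. *)
set d := ((e.+1) ^ n).+1.
have [A [g [cA sg ig]]] := he d.
pose b := (e * d).+1.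
pose C : 'M[k]_(#|A|, #|{: 'X_{1..n < b}}|) := \matrix_(a, m)
  (g (enum_val a))@_(enum_val m : 'X_{1..n < b}).
have : row_free C.
  rewrite -kermx_eq0; apply/rowV0P => c /sub_kermxP cC; apply/rowP => a.
  rewrite mxE -(enum_valK a); apply: (ig (fun a => c 0 (enum_rank a))).
  rewrite (_ : \sum_a _ = 0) //; apply/mpolyP => m; rewrite mcoeff0 raddf_sum /=.
  have [lt_m|le_m] := ltnP (mdeg m) b.
    have /matrixP/(_ 0 (enum_rank (BMultinom lt_m))) := cC; rewrite !mxE => e0; apply: etrans e0.
    rewrite [RHS](reindex enum_rank) /=; last by apply: onW_bij; apply: enum_rank_bij.
    by apply: eq_bigr => a' _; rewrite mxE !enum_rankK mcoeffCM.
  rewrite big1 // => a' _; rewrite mcoeffCM [X in _ * X](_ : _ = 0) ?mulr0 //.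
  apply/eqP; rewrite mcoeff_eq0; apply: msize_mdeg_ge; exact: leq_trans (sg _) le_m.
rewrite /row_free => /eqP rC; have := rank_leq_col C; rewrite rC cA.
apply/negP; rewrite -ltnNge.
have b_le : (b <= e.+1 * d)%N by rewrite mulSn addnC /b -addn1 leq_add2l.
apply: leq_ltn_trans (card_bmultinom b) _.
have mono q x y : (x <= y)%N -> (x ^ q <= y ^ q)%N by case: q => // q; rewrite leq_exp2r.
apply: leq_ltn_trans (mono _ _ _ b_le) _; rewrite expnMn.
have d_pow : (0 < d ^ n)%N by rewrite expn_gt0.
apply: leq_trans (_ : (_ < d ^ n.+1)%N) _; first by rewrite expnS ltn_pmul2r.
by rewrite leq_pexp2l.
Qed.

Lemma msize_mul_le (f g : R) : (msize (f * g) <= (msize f + msize g).-1)%N.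
Proof.
have [->|f0] := eqVneq f 0; first by rewrite mul0r mmeasure0.
have [->|g0] := eqVneq g 0; first by rewrite mulr0 mmeasure0.
by rewrite msizeM.
Qed.

Lemma msizeX_le (f : R) b : (msize (f ^+ b) <= (msize f * b).+1)%N.
Proof.
elim: b => [|b IH]; first by rewrite expr0 msize1.
rewrite exprS; apply: leq_trans (msize_mul_le _ _) _.
by rewrite mulnS -subn1 leq_subLR add1n -addnS; apply: leqW; rewrite leq_add2l.
Qed.

(** The products of the independent elements modulo [P] with 1, f, ..., f^(d-1)
    are independent modulo [P']: in a relation modulo the prime [P'], the lowest
    power of f can be cancelled, and modulo [P], where f is 0, only its
    coefficient remains. *)
Lemma growth_step P P' N f : is_ideal P -> is_ideal P' ->
  (forall g h, P' (g * h) -> P' g \/ P' h) -> (forall g, P' g -> P g) -> P f -> ~ P' f ->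
  growth P N -> growth P' N.+1.
Proof.
move=> [P0 PD PM] [P0' PD' PM'] prime sub Pf nPf [e he].
exists (e + msize f)%N => d; have [A [g [cA sg ig]]] := he d.
exists (A * 'I_d)%type, (fun ab : A * 'I_d => g ab.1 * f ^+ ab.2); split.
- by rewrite card_prod card_ord cA expnSr.
- move=> [a b] /=; apply: leq_trans (msize_mul_le _ _) _.
  have := sg a; have := msizeX_le f b; have := ltn_ord b.
  have : (msize f * b <= msize f * d)%N by rewrite leq_mul2l ltnW ?orbT.
  rewrite mulnDl; lia.
move=> c; rewrite (_ : \sum_a _ = \sum_a \sum_b (c (a, b))%:MP * (g a * f ^+ b)); last first.
  by rewrite pair_bigA; apply: eq_bigr => -[a b] _.
rewrite exchange_big /=.
pose S b := \sum_a (c (a, b))%:MP * g a.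
rewrite (eq_bigr (fun b : 'I_d => S b * f ^+ b)) => [|b _]; last first.
  by rewrite mulr_suml; apply: eq_bigr => a _; rewrite mulrA.
move=> hc; have cancel_f b h : P' (f ^+ b * h) -> P' h.
  elim: b => [|b IH]; first by rewrite expr0 mul1r.
  by rewrite exprS -mulrA => /prime [//|/IH].
(* The coefficients of f^0, f^1, ... vanish successively. *)
have vanish q : forall b : 'I_d, (b < q)%N -> forall a, c (a, b) = 0.
  elim: q => // q IH b; rewrite ltnS leq_eqVlt => /orP[/eqP eb|]; last exact: IH.
  move=> a; apply: (ig (fun a => c (a, b))); rewrite -/(S b).
  have S0 (b' : 'I_d) : (b' < b)%N -> S b' = 0.
    by move=> h; rewrite /S big1 // => a' _; rewrite IH -?eb // mpolyC0 mul0r.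
  have /(cancel_f b)/sub : P' (f ^+ b * \sum_(b' < d | (b <= b')%N) S b' * f ^+ (b' - b)).
    move: hc; rewrite (bigID (fun b' : 'I_d => (b <= b')%N)) /= [X in _ + X]big1 ?addr0 => [|b' h].
      congr P'; rewrite mulr_sumr; apply: eq_bigr => b' h.
      by rewrite mulrCA -exprD subnKC.
    by rewrite S0 ?mul0r // ltnNge.
  rewrite (bigD1 b) //= subnn expr0 mulr1 => hS.
  set Q := \sum_(b' < d | _) _ in hS.
  have PQ : P Q.
    apply: (big_ind P) => // b' /andP[h ne].
    have h' : (b < b')%N by rewrite ltn_neqAle h andbT eq_sym.
    rewrite -[(b' - b)%N]prednK ?subn_gt0 // exprSr mulrA; exact: PM.
  have -> : S b = (S b + Q) + (-1) * Q by rewrite mulN1r addrK.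
  by apply: PD => //; apply: PM.
by case=> a b; apply: (vanish d).
Qed.

End Growth.

(** * Parametrized closed sets *)

Section PointSystem.
Variables (k : fieldType) (n : nat).
Variables (X : Type) (closed : (X -> Prop) -> Prop).
Variables (Kp : X -> fieldType) (iota : forall x, {rmorphism k -> Kp x})
  (pt : forall x, 'I_n -> Kp x).

(** A space whose points [x] carry coordinates in a field [Kp x] over k: for the
    spectrum these are the residue fields, for k^n they are all equal to k. *)
Definition vanish (f : {mpoly k[n]}) (x : X) : Prop := mmap (iota x) (pt x) f = 0.

Definition param_subst N (theta : 'I_n -> {mpoly k[N]}) : {mpoly k[n]} -> {mpoly k[N]} :=
  mmap (@mpolyC N k) theta.

(** The closed image of the parametrization X_s |-> theta_s. *)
Definition param_image N (theta : 'I_n -> {mpoly k[N]}) (x : X) : Prop :=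
  forall f, param_subst theta f = 0 -> vanish f x.

Hypothesis closedP : forall F, closed F <->
  exists J : {mpoly k[n]} -> Prop, forall x, F x <-> forall f, J f -> vanish f x.
(** A polynomial that vanishes on the zero set of the kernel of a parametrization
    is in the kernel. In the spectrum, the kernel is itself a point of this zero
    set; in k^n, the hypothesis says that a nonzero polynomial in the parameters
    does not vanish everywhere. *)
Hypothesis dense : forall N (theta : 'I_n -> {mpoly k[N]}) f, param_subst theta f != 0 ->
  exists2 x, param_image theta x & ~ vanish f x.

Lemma vanishM f g x : vanish (f * g) x <-> vanish f x \/ vanish g x.
Proof.
rewrite /vanish rmorphM /=; split=> [/eqP|[->|->]]; rewrite ?mul0r ?mulr0 //.
by rewrite mulf_eq0 => /orP[/eqP|/eqP]; [left|right].
Qed.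

Lemma vanishD f g x : vanish f x -> vanish g x -> vanish (f + g) x.
Proof. by rewrite /vanish rmorphD /= => -> ->; rewrite addr0. Qed.

Lemma vanish0 x : vanish 0 x.
Proof. exact: rmorph0. Qed.

Definition vanishing_ideal (Z : X -> Prop) (f : {mpoly k[n]}) : Prop :=
  forall x, Z x -> vanish f x.

Lemma vanishing_is_ideal Z : is_ideal (vanishing_ideal Z).
Proof.
split=> [x _|f g hf hg x Zx|h f hf x Zx]; first exact: vanish0.
- by apply: vanishD; [apply: hf|apply: hg].
- by apply/vanishM; right; apply: hf.
Qed.

Lemma closed_vanish f : closed (vanish f).
Proof.
apply/closedP; exists (fun g => g = f) => x; split=> [h g -> //|]; by apply.
Qed.

Lemma vanishing_prime Z f g : irreducible closed Z ->
  vanishing_ideal Z (f * g) -> vanishing_ideal Z f \/ vanishing_ideal Z g.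
Proof.
move=> [_ irr] h; have [||x Zx|hf|hg] := irr (vanish f) (vanish g); try exact: closed_vanish.
- by apply/vanishM; apply: h.
- by left.
- by right.
Qed.

(** Closed sets are determined by their vanishing ideals. *)
Lemma vanishing_strict F G : closed F -> ~ incl G F ->
  exists f, vanishing_ideal F f /\ ~ vanishing_ideal G f.
Proof.
move=> /closedP [J hJ] nGF; apply: NNPP => h; apply: nGF => x Gx; apply/hJ => f Jf.
apply: NNPP => nf; apply: h; exists f; split=> [y /hJ|hf]; first exact.
by apply: nf; apply: hf.
Qed.

Section ParamImage.
Variables (N : nat) (theta : 'I_n -> {mpoly k[N]}).

Lemma closed_param_image : closed (param_image theta).
Proof. by apply/closedP; exists (fun f => param_subst theta f = 0). Qed.

Lemma vanishing_param_image f : vanishing_ideal (param_image theta) f <-> param_subst theta f = 0.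
Proof.
split=> [h|f0 x]; last exact.
by apply/eqP; apply: contraT => /dense [x /h].
Qed.

(** Its vanishing ideal is the kernel of a map to a domain. *)
Lemma irreducible_param_image : irreducible closed (param_image theta).
Proof.
split.
  have [|x hx _] := @dense _ theta 1; last by exists x.
  by rewrite [param_subst _ _]rmorph1 oner_eq0.
move=> F G cF cG FG; apply: NNPP => /not_or_and [nF nG].
have [f [Ff nf]] := vanishing_strict cF nF; have [g [Gg ng]] := vanishing_strict cG nG.
have : vanishing_ideal (param_image theta) (f * g).
  by move=> x /FG [Fx|Gx]; apply/vanishM; [left; apply: Ff | right; apply: Gg].
rewrite vanishing_param_image [param_subst _ _]rmorphM => /eqP; rewrite mulf_eq0 => /orP[]/eqP.
  by rewrite -[_ = _]vanishing_param_image.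
by rewrite -[_ = _]vanishing_param_image.
Qed.

End ParamImage.

(** The lower bound on the codimension: a chain of parametrizations. *)
Lemma param_chain (Z : X -> Prop) N (theta : nat -> 'I_n -> {mpoly k[N]}) c :
  (forall x, param_image (theta 0%N) x <-> Z x) ->
  (forall i f, (i < c)%N -> param_subst (theta i.+1) f = 0 -> param_subst (theta i) f = 0) ->
  (forall i, (i < c)%N -> exists2 f, param_subst (theta i) f = 0 & param_subst (theta i.+1) f != 0) ->
  irr_chain closed Z c.
Proof.
move=> h0 hsub hne; exists (fun i => param_image (theta i)); split=> // i ic.
  by split; [apply: closed_param_image | apply: irreducible_param_image].
split=> [x hx f /hsub|h]; first by move=> /(_ ic); apply: hx.
have [f f0 /dense [x /h hx]] := hne i ic; apply; exact: hx.
Qed.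

(** The upper bound on the codimension: the vanishing ideals of the chain are
    primes, and each strict inclusion adds 1 to the growth, by [growth_step]. *)
Lemma chain_growth Z D l : growth (vanishing_ideal Z) D -> irr_chain closed Z l -> (D + l <= n)%N.
Proof.
move=> gZ [F [F0 Fi Fs]].
have gF i : (i <= l)%N -> growth (vanishing_ideal (F i)) (D + i).
  elim: i => [|i IH] il.
    rewrite addn0; have [e he] := gZ; exists e => d; have [A [g [cA sg ig]]] := he d.
    exists A, g; split=> // c h; apply: ig => x Zx; apply: h; exact/F0.
  have [cl irr] := Fi _ il; have [incF nincF] := Fs _ il.
  have [f [If nf]] := vanishing_strict (proj1 (Fi _ (ltnW il))) nincF.
  rewrite addnS; apply: (growth_step _ _ _ _ If nf (IH (ltnW il))).
  - exact: vanishing_is_ideal. - exact: vanishing_is_ideal.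
  - by move=> g h; apply: vanishing_prime.
  - by move=> g hg x /incF; apply: hg.
apply: growth_le (gF l (leqnn l)); by move=> x _; apply: vanish0.
Qed.

End PointSystem.

(** * Ranks and minors *)

Lemma rank_factor (K : fieldType) (m q r : nat) (A : 'M[K]_(m, q)) : (\rank A <= r)%N ->
  exists (B : 'M_(m, r)) (C : 'M_(r, q)), A = B *m C.
Proof.
move=> hr; exists (col_ebase A *m pid_mx (\rank A)), (pid_mx (\rank A) *m row_ebase A).
rewrite -{1}(mulmx_ebase A) !mulmxA; congr (_ *m _); rewrite -!mulmxA; congr (_ *m _).
by rewrite mul_pid_mx minnn (minn_idPr hr).
Qed.

(** Over the field of fractions the product has rank at most [r]. *)
Lemma det_mul_small (R : idomainType) (s r : nat) (B : 'M[R]_(s, r)) (C : 'M_(r, s)) :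
  (r < s)%N -> \det (B *m C) = 0.
Proof.
move=> rs; apply/eqP; rewrite -(tofrac_eq0 (\det _)) -[_ (\det _)]det_map_mx map_mxM.
set A := (_ *m _); apply: contraTT rs => dA.
have : A \in unitmx by rewrite unitmxE unitfE.
rewrite -row_full_unit /row_full -leqNgt => /eqP <-.
exact: leq_trans (mxrankM_maxl _ _) (rank_leq_col _).
Qed.

(** Select independent rows spanning the row space, then independent columns of
    these rows. *)
Lemma rank_minor (K : fieldType) (m q : nat) (A : 'M[K]_(m, q)) :
  exists (f : 'I_(\rank A) -> 'I_m) (g : 'I_(\rank A) -> 'I_q), \det (mxsub f g A) != 0.
Proof.
pose f := maxrankfun A; pose B := rowsub f A.
have fullB : row_full B^T by rewrite /row_full mxrank_tr; apply: maxrowsub_free.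
exists f, (fullrankfun fullB).
have := fullrowsub_full fullB; rewrite row_full_unit unitmxE unitfE.
by rewrite -det_tr; congr (\det _ != 0); apply/matrixP => i j; rewrite !mxE.
Qed.

(** * Parametrized determinantal sets *)

Section Determinantal.
Variables (k : fieldType) (n m q : nat) (sigma : 'I_m * 'I_q -> 'I_n).
Hypothesis sigma_inj : injective sigma.

Definition point_mx (S : pzRingType) (p : 'I_n -> S) : 'M[S]_(m, q) :=
  \matrix_(i, j) p (sigma (i, j)).

Section Parametrization.
Variable r : nat.

(** Entries of an m x r matrix B, entries of an r x q matrix C, and one free value
    for each coordinate of the space. *)
Definition param_type : finType := (('I_m * 'I_r) + ('I_r * 'I_q) + 'I_n)%type.
Definition nparam : nat := #|{: param_type}|.

Definition param_var (a : param_type) : {mpoly k[nparam]} := 'X_(enum_rank a).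

(** The matrix B C at the positions [sigma], to which the value of [z] is added at
    the coordinates in [T]; the others are 0 off the matrix. *)
Definition point_of (S : pzRingType) (T : {set 'I_n}) (B : 'M[S]_(m, r)) (C : 'M[S]_(r, q))
    (z : 'I_n -> S) (s : 'I_n) : S :=
  \sum_(ij | sigma ij == s) (B *m C) ij.1 ij.2 + (if s \in T then z s else 0).

Definition theta (T : {set 'I_n}) : 'I_n -> {mpoly k[nparam]} :=
  point_of T (\matrix_(i, a) param_var (inl (inl (i, a))))
    (\matrix_(a, j) param_var (inl (inr (a, j)))) (fun s => param_var (inr s)).

Lemma point_of_sigma (S : pzRingType) T (B : 'M[S]_(m, r)) C z ij :
  point_of T B C z (sigma ij) =
  (B *m C) ij.1 ij.2 + (if sigma ij \in T then z (sigma ij) else 0).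
Proof.
rewrite /point_of (eq_bigl (pred1 ij)) ?big_pred1_eq // => ij'.
by rewrite /= (inj_eq sigma_inj).
Qed.

Lemma param_subst_point (S : comNzRingType) (iota : {rmorphism k -> S}) T
    (B : 'M[S]_(m, r)) C z f :
  exists y : 'I_nparam -> S,
    mmap iota (point_of T B C z) f = mmap iota y (param_subst (theta T) f).
Proof.
pose y (e : 'I_nparam) : S := match enum_val e with
  | inl (inl ia) => B ia.1 ia.2 | inl (inr aj) => C aj.1 aj.2 | inr s => z s end.
exists y; have yE a : mmap iota y (param_var a) = match a with
  | inl (inl ia) => B ia.1 ia.2 | inl (inr aj) => C aj.1 aj.2 | inr s => z s end.
  by rewrite /param_var mmapX mmap1U /y enum_rankK.
have yT s : point_of T B C z s = mmap iota y (theta T s).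
  rewrite rmorphD rmorph_sum /=; congr (_ + _).
    apply: eq_bigr => ij _; rewrite !mxE rmorph_sum; apply: eq_bigr => a _.
    by rewrite /= rmorphM /= !mxE !yE.
  by case: ifP => _; rewrite ?rmorph0 ?yE.
elim/mpoly_ind_gen: f => [c|s|f g|f g].
- by rewrite /param_subst !mmapC.
- by rewrite /param_subst [in RHS]mmapX mmapX !mmap1U yT.
- by rewrite /param_subst !rmorphD /= => -> ->.
- by rewrite /param_subst !rmorphM /= => -> ->.
Qed.

Lemma param_subst0_point (S : comNzRingType) (iota : {rmorphism k -> S}) T
    (B : 'M[S]_(m, r)) C z f :
  param_subst (theta T) f = 0 -> mmap iota (point_of T B C z) f = 0.
Proof.
by move=> f0; have [y ->] := param_subst_point iota T B C z f; rewrite f0 rmorph0.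
Qed.

(** Fewer free coordinates give a smaller image: set the others to 0. *)
Lemma param_subst_mono (T T' : {set 'I_n}) f : T \subset T' ->
  param_subst (theta T') f = 0 -> param_subst (theta T) f = 0.
Proof.
move=> sT f0; rewrite /param_subst.
pose z s : {mpoly k[nparam]} := if s \in T then param_var (inr s) else 0.
pose B : 'M_(m, r) := \matrix_(i, a) param_var (inl (inl (i, a))).
pose C : 'M_(r, q) := \matrix_(a, j) param_var (inl (inr (a, j))).
rewrite -(param_subst0_point (@mpolyC nparam k) (T := T') B C z f0).
have e s : theta T s = point_of T' B C z s.
  rewrite /theta /point_of /z; congr (_ + _).
  by case: (boolP (s \in T)) => [/(subsetP sT) ->|_] //; rewrite if_same.
elim/mpoly_ind_gen: f {f0} => [c|s|f g|f g].
- by rewrite !mmapC.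
- by rewrite !mmapX !mmap1U e.
- by rewrite !rmorphD /= => -> ->.
- by rewrite !rmorphM /= => -> ->.
Qed.

End Parametrization.

Definition generic_mx : 'M[{mpoly k[n]}]_(m, q) := \matrix_(i, j) 'X_(sigma (i, j)).

Lemma mmap_minor (S : comNzRingType) (iota : {rmorphism k -> S}) (p : 'I_n -> S) s
    (f : 'I_s -> 'I_m) (g : 'I_s -> 'I_q) :
  mmap iota p (\det (mxsub f g generic_mx)) = \det (mxsub f g (point_mx p)).
Proof.
rewrite -det_map_mx; congr (\det _); apply/matrixP => i j.
by rewrite !mxE /= mmapX mmap1U.
Qed.

Definition outer : {set 'I_n} := ~: [set sigma ij | ij : 'I_m * 'I_q].

Lemma sigma_outer ij : (sigma ij \in outer) = false.
Proof. by apply/negbTE; rewrite inE negbK imset_f. Qed.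

Lemma point_mx_outer r (S : pzRingType) (B : 'M[S]_(m, r)) C z :
  point_mx (point_of outer B C z) = B *m C.
Proof. by apply/matrixP => i j; rewrite mxE point_of_sigma sigma_outer addr0. Qed.

Lemma point_of_outerK r (S : pzRingType) (B : 'M[S]_(m, r)) C p :
  point_mx p = B *m C -> point_of outer B C p =1 p.
Proof.
move=> e s; have [h|] := boolP (s \in outer).
  rewrite /point_of h big_pred0 ?add0r // => ij; apply/negbTE.
  by apply: contraTneq h => <-; rewrite sigma_outer.
by rewrite inE negbK => /imsetP [[i j] _ ->]; rewrite point_of_sigma sigma_outer addr0 -e mxE.
Qed.

(** A matrix of rank at most r factors as B C, hence is a point of the
    parametrization with all coordinates of the matrix determined by B and C.
    Conversely a minor of size s > r is in the kernel, as the determinant of a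
    product through a space of dimension r. *)
Lemma rank_le_iff r (K : fieldType) (iota : {rmorphism k -> K}) (p : 'I_n -> K) :
  (\rank (point_mx p) <= r)%N <->
  forall f, param_subst (theta r outer) f = 0 -> mmap iota p f = 0.
Proof.
split=> [/rank_factor [B [C e]] f f0|h].
  rewrite -(param_subst0_point iota B C p f0); apply: eq_bigr => mm _.
  by congr (_ * _); apply: mmap1_eq => s; rewrite (point_of_outerK e).
have [f [g nz]] := rank_minor (point_mx p); rewrite leqNgt; apply: contra_neqN nz => hr.
rewrite -(mmap_minor iota); apply: h; rewrite /param_subst mmap_minor.
rewrite point_mx_outer mxsub_mul; exact: det_mul_small.
Qed.

Section RankBound.
Variable r : nat.
Hypotheses (rm : (r <= m)%N) (rq : (r <= q)%N).

Definition corner_minor : {mpoly k[n]} :=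
  \det (mxsub (widen_ord rm) (widen_ord rq) generic_mx).

(** It takes the value 1 for B and C partial identity matrices. *)
Lemma corner_minor_subst : param_subst (theta r outer) corner_minor != 0.
Proof.
apply/eqP => h; have := param_subst0_point (idfun : {rmorphism k -> k}) (pid_mx r) (pid_mx r) (fun _ => 0) h.
rewrite mmap_minor point_mx_outer mul_pid_mx !minnn.
have -> : mxsub (widen_ord rm) (widen_ord rq) (pid_mx r) = 1%:M :> 'M[k]_r.
  by apply/matrixP => i j; rewrite !mxE /= ltn_ord andbT.
by rewrite det1 => /eqP; rewrite oner_eq0.
Qed.

Lemma corner_minor_rank (K : fieldType) (iota : {rmorphism k -> K}) p :
  mmap iota p corner_minor <> 0 -> (r <= \rank (point_mx p))%N.
Proof.
rewrite mmap_minor => /eqP; set A := mxsub _ _ _ => dA.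
have /eqP <- : row_full A by rewrite row_full_unit unitmxE unitfE.
have -> : A = rowsub (widen_ord rm) (point_mx p) *m colsub (widen_ord rq) 1%:M.
  by rewrite -mxsub_mul mulmx1.
by apply: leq_trans (mxrankM_maxl _ _) _; apply/mxrankS/rowsub_sub.
Qed.

Definition lower_block : {set 'I_m * 'I_q} :=
  [set ij : 'I_m * 'I_q | (r <= ij.1)%N && (r <= ij.2)%N].

Lemma card_ord_ge s : #|[set i : 'I_s | (r <= i)%N]| = (s - r)%N.
Proof.
rewrite cardsE -sum1_card -(big_mkord (fun i => (r <= i)%N) (fun _ => 1%N)) /=.
by rewrite -(big_nat_widenl r 0 s xpredT) // sum_nat_const_nat muln1.
Qed.

Lemma card_lower_block : #|lower_block| = ((m - r) * (q - r))%N.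
Proof.
rewrite -(card_ord_ge m) -(card_ord_ge q) -cardsX; congr #|pred_of_set _|.
by apply/setP => -[i j]; rewrite !inE.
Qed.

(** From the matrices of rank at most r, where the lower block is determined by
    the rest, the positions of the lower block are freed one by one. *)
Definition free_coords (i : nat) : {set 'I_n} :=
  outer :|: [set sigma ij | ij in take i (enum lower_block)].

Lemma free_coords0 : free_coords 0 = outer.
Proof. by rewrite /free_coords take0 (_ : [set _ | _ in _] = set0) ?setU0 //; apply/setP => s; rewrite inE; apply/negbTE/imsetP => -[]. Qed.

Lemma sigma_free_coords i ij : (sigma ij \in free_coords i) = (ij \in take i (enum lower_block)).
Proof. by rewrite inE sigma_outer /= mem_imset. Qed.

Lemma free_coords_mono i : free_coords i \subset free_coords i.+1.
Proof.
apply: setUS; apply/subsetP => s /imsetP [ij h ->]; apply: imset_f.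
have [lt|le] := ltnP i (size (enum lower_block)); last by rewrite take_oversize ?leqW // -(take_oversize le).
by rewrite (take_nth ij lt) mem_rcons inE h orbT.
Qed.

(** The minor on the first r rows and columns bordered by those of position number
    i. If this position is not free, the minor is that of B C, of rank at most r,
    and vanishes. If it is free, the minor takes the value 1 at partial identity matrices B and C
    and the value 1 of the free coordinate. *)
Lemma bordered_minor i : (i < #|lower_block|)%N ->
  exists2 f, param_subst (theta r (free_coords i)) f = 0 &
             param_subst (theta r (free_coords i.+1)) f != 0.
Proof.
rewrite cardE => ilt; have [e0 _] : exists e0 : 'I_m * 'I_q, e0 \in lower_block.
  case e : (enum lower_block) ilt => [//|e0 s] _; exists e0.
  by rewrite -mem_enum e inE eqxx.
pose e := nth e0 (enum lower_block) i; have := mem_nth e0 ilt; rewrite -/e mem_enum inE.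
case ee : e => [i0 j0] /= /andP [ri0 rj0].
pose rho (a : 'I_r.+1) := if unlift ord_max a is Some a' then widen_ord rm a' else i0.
pose gam (a : 'I_r.+1) := if unlift ord_max a is Some a' then widen_ord rq a' else j0.
have rhoE a : (rho a < r)%N = (a < r)%N.
  rewrite /rho; case: unliftP => [a' ->|->]; rewrite ?lift_max /= ?ltn_ord //.
  by rewrite ltnNge ri0 ltnn.
have gamE a : (gam a < r)%N = (a < r)%N.
  rewrite /gam; case: unliftP => [a' ->|->]; rewrite ?lift_max /= ?ltn_ord //.
  by rewrite ltnNge rj0 ltnn.
exists (\det (mxsub rho gam generic_mx)).
  rewrite /param_subst mmap_minor.
  set B : 'M_(m, r) := \matrix_(i, a) param_var (inl (inl (i, a))).
  set C : 'M_(r, q) := \matrix_(a, j) param_var (inl (inr (a, j))).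
  rewrite (_ : mxsub _ _ _ = rowsub rho B *m colsub gam C) ?det_mul_small //.
  rewrite -mxsub_mul; apply/matrixP => a b; rewrite [LHS]mxE [RHS]mxE mxE.
  rewrite /theta point_of_sigma sigma_free_coords ifF ?addr0 //.
  apply/negP => h; have : (rho a, gam b) \in lower_block.
    by rewrite -mem_enum; apply: mem_take h.
  rewrite inE /= => /andP [ra rb].
  have ea : a = ord_max.
    apply: val_inj => /=; apply/eqP; rewrite eqn_leq -ltnS ltn_ord leqNgt -rhoE -leqNgt; exact: ra.
  have eb : b = ord_max.
    apply: val_inj => /=; apply/eqP; rewrite eqn_leq -ltnS ltn_ord leqNgt -gamE -leqNgt; exact: rb.
  move: h; rewrite ea eb /rho /gam unlift_none -ee /e.
  by rewrite in_take_leq ?index_uniq ?enum_uniq // ?ltnn // ltnW.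
apply/eqP => h.
pose z s : k := (s == sigma (i0, j0))%:R.
have := param_subst0_point (idfun : {rmorphism k -> k}) (pid_mx r) (pid_mx r) z h.
rewrite mmap_minor (_ : mxsub _ _ _ = 1%:M) ?det1; first by move/eqP; rewrite oner_eq0.
apply/matrixP => a b; rewrite [LHS]mxE mxE point_of_sigma sigma_free_coords /=.
rewrite mul_pid_mx !minnn !mxE rhoE /z (inj_eq sigma_inj).
have in0 : (i0, j0) \in take i.+1 (enum lower_block).
  by rewrite (take_nth e0 ilt) mem_rcons inE -ee eqxx.
have -> : (if (rho a, gam b) \in take i.+1 (enum lower_block)
           then ((rho a, gam b) == (i0, j0))%:R else 0) = ((rho a == i0) && (gam b == j0))%:R :> k.
  by rewrite xpair_eqE; case: (altP andP) => [[/eqP -> /eqP ->]|]; rewrite ?in0 ?if_same.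
have neq_i (a' : 'I_r) : (widen_ord rm a' == i0) = false.
  by apply/negbTE; rewrite -val_eqE /= neq_ltn (leq_trans (ltn_ord a') ri0).
have neq_j (b' : 'I_r) : (widen_ord rq b' == j0) = false.
  by apply/negbTE; rewrite -val_eqE /= neq_ltn (leq_trans (ltn_ord b') rj0).
rewrite /rho /gam; case: (unliftP ord_max a) => [a' ->|->]; case: (unliftP ord_max b) => [b' ->|->];
  rewrite ?lift_max /= ?neq_i ?neq_j ?andbF ?eqxx ?addr0 ?ltnn ?andbF.
- by rewrite (inj_eq lift_inj) ltn_ord andbT.
- rewrite [lift _ _ == _]eq_sym eq_liftF (_ : (_ == _) = false) //.
  by apply/negbTE; rewrite neq_ltn (leq_trans (ltn_ord a') rj0).
- by rewrite eq_liftF.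
- by rewrite add0r.
Qed.

(** The coordinates off the lower block are algebraically independent on the
    matrices of rank at most r: over the field of fractions, a matrix with
    indeterminate entries in the first r rows and columns can be completed
    to a matrix of rank r. *)
Lemma generic_completion : exists (B : 'M_(m, r)) (C : 'M_(r, q)) (z : 'I_n -> {fraction {mpoly k[n]}}),
  forall s, s \notin [set sigma ij | ij in lower_block] ->
    point_of outer B C z s = tofrac 'X_s.
Proof.
pose f := widen_ord rm; pose g := widen_ord rq.
pose G : 'M[{fraction {mpoly k[n]}}]_(m, q) := map_mx (@tofrac _) generic_mx.
pose D : 'M[{fraction {mpoly k[n]}}]_r := mxsub f g G.
have uD : D \in unitmx.
  rewrite unitmxE unitfE (_ : \det D = tofrac corner_minor) ?tofrac_eq0; last first.
    by rewrite -[RHS]det_map_mx; congr (\det _); apply/matrixP => i j; rewrite !mxE.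
  by apply: contraNneq corner_minor_subst => ->; rewrite /param_subst rmorph0.
(* C is chosen such that B C agrees with G on the first r rows and columns. *)
pose B := colsub g G; pose C := invmx D *m rowsub f G.
have row_eq : rowsub f (B *m C) = rowsub f G.
  rewrite -mul_rowsub_mx mulmxA (_ : rowsub f B = D) ?mulmxV ?mul1mx //.
  by apply/matrixP => i j; rewrite !mxE.
have col_eq : colsub g (B *m C) = colsub g G.
  rewrite -mulmx_colsub -mulmx_colsub (_ : colsub g (rowsub f G) = D) ?mulVmx ?mulmx1 //.
  by apply/matrixP => i j; rewrite !mxE.
exists B, C, (fun s => tofrac 'X_s) => s hs.
have [so|] := boolP (s \in outer).
  rewrite /point_of so big_pred0 ?add0r // => ij; apply/negbTE.
  by apply: contraTneq so => <-; rewrite sigma_outer.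
rewrite inE negbK => /imsetP [[i j] _ es].
rewrite es point_of_sigma sigma_outer addr0 /=.
have : (i, j) \notin lower_block by apply: contraNN hs => h; rewrite es imset_f.
rewrite inE negb_and -!ltnNge /= => /orP[lt|lt].
  have -> : i = f (Ordinal lt) by apply: val_inj.
  by have /matrixP/(_ (Ordinal lt) j) := row_eq; rewrite [LHS]mxE !mxE.
have -> : j = g (Ordinal lt) by apply: val_inj.
by have /matrixP/(_ i (Ordinal lt)) := col_eq; rewrite [LHS]mxE !mxE.
Qed.

(** The monomials in the coordinates off the lower block are independent modulo
    the kernel, by [generic_completion]. *)
Lemma rank_growth (P : {mpoly k[n]} -> Prop) :
  (forall f, P f -> param_subst (theta r outer) f = 0) ->
  growth P (n - (m - r) * (q - r)).
Proof.
move=> hP; pose free : {set 'I_n} := ~: [set sigma ij | ij in lower_block].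
have card_free : #|free| = (n - (m - r) * (q - r))%N.
  by rewrite cardsCs setCK card_ord card_imset // card_lower_block.
exists n => d; pose U := {s | s \in free}.
pose mon (e : {ffun U -> 'I_d}) : 'X_{1..n} :=
  [multinom (if insub s is Some u then e u : nat else 0%N) | s < n].
have mon_inj : injective mon.
  move=> e e' /mnmP h; apply/ffunP => u; apply: val_inj.
  by have := h (val u); rewrite !mnmE valK.
exists {ffun U -> 'I_d}, (fun e => 'X_[mon e]); split.
- by rewrite card_ffun card_ord card_sig; congr (_ ^ _)%N; rewrite -card_free; apply: eq_card.
- move=> e; rewrite msizeX ltnS mdegE.
  apply: leq_trans (_ : \sum_(s < n) d <= _)%N; last by rewrite sum_nat_const card_ord.
  by apply: leq_sum => s _; rewrite mnmE; case: insub => // u; apply: ltnW.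
move=> c /hP hc e0.
have [B [C [z hz]]] := generic_completion.
have := param_subst0_point (@tofrac _ \o @mpolyC n k) B C z hc.
set p := point_of _ _ _ _ in hz *.
have -> : mmap (@tofrac _ \o @mpolyC n k) p (\sum_e (c e)%:MP * 'X_[mon e]) =
    tofrac (\sum_e (c e)%:MP * 'X_[mon e]).
  rewrite !rmorph_sum; apply: eq_bigr => e _; rewrite !rmorphM /= mmapC mmapX /=.
  congr (_ * _); rewrite mpolyXE_id rmorph_prod; apply: eq_bigr => s _.
  rewrite rmorphXn /= mnmE; case: insubP => [u us _|_]; last by rewrite !expr0.
  by rewrite hz //; move: us; rewrite inE.
move/eqP; rewrite tofrac_eq0 => /eqP/(congr1 (mcoeff (mon e0))).
rewrite mcoeff0 raddf_sum (bigD1 e0) //= mcoeffCM mcoeffX eqxx mulr1 big1 ?addr0 // => e ne.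
by rewrite mcoeffCM mcoeffX (inj_eq mon_inj) (negbTE ne) mulr0.
Qed.

End RankBound.

(** * Rank loci in a system of points *)

Section RankLocus.
Variables (X : Type) (closed : (X -> Prop) -> Prop).
Variables (Kp : X -> fieldType) (iota : forall x, {rmorphism k -> Kp x})
  (pt : forall x, 'I_n -> Kp x).
Hypothesis closedP : forall F, closed F <->
  exists J : {mpoly k[n]} -> Prop, forall x, F x <-> forall f, J f -> vanish iota pt f x.
Hypothesis dense : forall N (theta : 'I_n -> {mpoly k[N]}) f, param_subst theta f != 0 ->
  exists2 x, param_image iota pt theta x & ~ vanish iota pt f x.

Definition rank_le (r : nat) (x : X) : Prop := (\rank (point_mx (pt x)) <= r)%N.
Definition rank_eq (r : nat) (x : X) : Prop := \rank (point_mx (pt x)) = r.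

Lemma rank_leE r x : rank_le r x <-> param_image iota pt (theta r outer) x.
Proof. exact: rank_le_iff. Qed.

Lemma irreducible_ext (Z Z' : X -> Prop) : (forall x, Z x <-> Z' x) ->
  irreducible closed Z -> irreducible closed Z'.
Proof.
move=> h [[x Zx] irr]; split; first by exists x; apply/h.
move=> F G cF cG FG; have [y /h/FG //|i|i] := irr F G cF cG; [left|right] => y /h; exact: i.
Qed.

Lemma irreducible_rank_le r : irreducible closed (rank_le r).
Proof.
apply: irreducible_ext (irreducible_param_image closedP dense (theta r outer)) => x.
by rewrite rank_leE.
Qed.

(** Multiplying by the corner minor forces the rank of the point to be exactly
    [r]. *)
Lemma rank_eq_dense r f : (r <= m)%N -> (r <= q)%N -> param_subst (theta r outer) f != 0 ->
  exists2 x, rank_eq r x & ~ vanish iota pt f x.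
Proof.
move=> rm rq nf; have [|x hx] := dense (theta := theta r outer) (f := f * corner_minor rm rq).
  by rewrite /param_subst rmorphM mulf_neq0 //; apply: corner_minor_subst.
move=> nv; exists x; last by move=> vf; apply: nv; apply/vanishM; left.
apply/eqP; rewrite eqn_leq (proj2 (rank_leE r x) hx) /=.
by apply: (@corner_minor_rank r rm rq _ (iota x)) => vg; apply: nv; apply/vanishM; right.
Qed.

Lemma exists_rank_eq r : (exists x, rank_eq r x) <-> (r <= m)%N && (r <= q)%N.
Proof.
split=> [[x <-]|/andP [rm rq]]; first by rewrite rank_leq_row rank_leq_col.
have [|x hx _] := @rank_eq_dense r 1 rm rq; last by exists x.
by rewrite /param_subst rmorph1 oner_eq0.
Qed.

Lemma rank_le_closure r x : (r <= m)%N -> (r <= q)%N ->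
  rank_le r x <-> top_closure closed (rank_eq r) x.
Proof.
move=> rm rq; rewrite rank_leE; split=> [hx F cF incF|].
  move/closedP: (cF) => [J hJ]; apply/hJ => f Jf.
  suff f0 : param_subst (theta r outer) f = 0 by apply: hx.
  apply/eqP; apply: contraT => /(rank_eq_dense rm rq) [y /incF /hJ hy].
  by case; apply: hy.
apply; first exact: closed_param_image closedP _ _.
by move=> y ry; apply/rank_leE; rewrite /rank_le ry.
Qed.

(** The lower bound is the chain that frees the lower block, of (m-r)(q-r)
    positions. For the upper bound, the remaining n - (m-r)(q-r) coordinates
    are independent, and the members of a chain add to them. *)
Lemma rank_le_codim r : (r <= m)%N -> (r <= q)%N ->
  has_codim closed (rank_le r) ((m - r) * (q - r)).
Proof.
move=> rm rq; split.
  apply: (param_chain closedP dense (theta := fun i => theta r (free_coords r i))).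
  - by move=> x; rewrite free_coords0 rank_leE.
  - by move=> i f _; apply: param_subst_mono; apply: free_coords_mono.
  - by move=> i; rewrite -(card_lower_block r); apply: bordered_minor.
move=> l ch; have := chain_growth closedP (D := n - (m - r) * (q - r)) _ ch.
have le_n : ((m - r) * (q - r) <= n)%N.
  rewrite -(card_lower_block r) -(card_imset (mem (lower_block r)) sigma_inj).
  by rewrite -[n in X in (_ <= X)%N]card_ord max_card.
suff g : growth (vanishing_ideal iota pt (rank_le r)) (n - (m - r) * (q - r)).
  by move=> /(_ g); lia.
apply: (rank_growth rm rq) => f hf; apply/(vanishing_param_image dense) => x /rank_leE; exact: hf.
Qed.

End RankLocus.

End Determinantal.

(** * Nonvanishing over an infinite field *)

Lemma infinite_uniq (k : fieldType) : infinite_field k ->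
  forall d, exists2 s : seq k, size s = d & uniq s.
Proof.
move=> inf; elim=> [|d [s ss us]]; first by exists [::].
by have [x hx] := inf s; exists (x :: s); rewrite /= ?ss ?hx.
Qed.

Lemma infinite_nonroot (k : fieldType) (P : {poly k}) : infinite_field k -> P != 0 ->
  exists a, P.[a] != 0.
Proof.
move=> /infinite_uniq inf P0; have [s ss us] := inf (size P).
apply: NNPP => h; have := max_poly_roots P0 _ us; rewrite ss ltnn => H.
suff : false by []; apply: H; apply/allP => a _; apply/rootP.
by apply: NNPP => /eqP ha; apply: h; exists a.
Qed.

(** Induction on the number of variables: specialize all but the last one so
    that the leading coefficient in the last one does not vanish. *)
Lemma infinite_nonvanishing (k : fieldType) N (f : {mpoly k[N]}) : infinite_field k -> f != 0 ->
  exists v, f.@[v] != 0.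
Proof.
move=> inf; elim: N f => [|N IH] f f0.
  have fE : f = (f@_0%MM)%:MP.
    apply/mpolyP => n; have -> : n = 0%MM by apply/mnmP => -[].
    by rewrite mcoeffC eqxx mulr1.
  exists (fun _ => 0); apply: contraNneq f0 => fv.
  by rewrite fE mevalC in fv; rewrite fE fv mpolyC0.
pose h (i : 'I_N.+1) : {poly {mpoly k[N]}} := if unlift ord_max i is Some j then ('X_j)%:P else 'X.
have [U [UC UX]] : exists U : {rmorphism {mpoly k[N.+1]} -> {poly {mpoly k[N]}}},
    (forall c, U c%:MP = (c%:MP)%:P) /\ forall i, U 'X_i = h i.
  pose const : {rmorphism k -> {poly {mpoly k[N]}}} := polyC \o @mpolyC N k.
  by exists (mmap const h); split=> [c|i]; [exact: mmapC|rewrite [LHS]mmapX mmap1U].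
have [W [WC WX]] : exists W : {rmorphism {mpoly k[N]} -> {mpoly k[N.+1]}},
    (forall c, W c%:MP = c%:MP) /\ forall j, W 'X_j = 'X_(lift ord_max j).
  exists (mmap (@mpolyC N.+1 k) (fun j => 'X_(lift ord_max j))).
  by split=> [c|j]; [exact: mmapC|rewrite [LHS]mmapX mmap1U].
have WU g : (map_poly W (U g)).['X_ord_max] = g.
  elim/mpoly_ind_gen: g => [c|i|g1 g2 e1 e2|g1 g2 e1 e2].
  - by rewrite UC map_polyC hornerC /= WC.
  - rewrite UX /h; case: unliftP => [j ->|->].
      by rewrite map_polyC hornerC /= WX.
    by rewrite map_polyX hornerX.
  - by rewrite (rmorphD U) (rmorphD (map_poly W)) hornerD e1 e2.
  - by rewrite (rmorphM U) (rmorphM (map_poly W)) hornerM e1 e2.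
have Uf : U f != 0 by apply: contraNneq f0 => e; rewrite -(WU f) e rmorph0 horner0.
have [v hv] : exists v, (lead_coef (U f)).@[v] != 0 by apply: IH; rewrite lead_coef_eq0.
have [|c hc] := @infinite_nonroot k (map_poly (meval v) (U f)) inf.
  apply: contraNneq hv => /(congr1 (fun Q : {poly k} => Q`_(size (U f)).-1)).
  by rewrite coef_map coef0 /= => ->.
exists (fun i => if unlift ord_max i is Some j then v j else c).
suff -> : f.@[fun i => if unlift ord_max i is Some j then v j else c] =
    (map_poly (meval v) (U f)).[c] by [].
elim/mpoly_ind_gen: f {f0 Uf hv hc} => [b|i|g1 g2 e1 e2|g1 g2 e1 e2].
- by rewrite mevalC UC map_polyC hornerC /= mevalC.
- rewrite mevalXU UX /h /=; case: unliftP => [j _|_].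
    by rewrite map_polyC hornerC /= mevalXU.
  by rewrite map_polyX hornerX.
- by rewrite mevalD e1 e2 (rmorphD U) (rmorphD (map_poly (meval v))) hornerD.
- by rewrite mevalM e1 e2 (rmorphM U) (rmorphM (map_poly (meval v))) hornerM.
Qed.

(** * The points of Spec k[X_1, ..., X_n] *)

Section SpecPoints.
Variables (k : fieldType) (n : nat).

Section Kernel.
Variables (N : nat) (theta : 'I_n -> {mpoly k[N]}).

Definition param_kernel (f : {mpoly k[n]}) : bool := param_subst theta f == 0.

Lemma param_kernel_ideal : idealr_closed param_kernel.
Proof.
split.
- by rewrite unfold_in /param_kernel /param_subst rmorph0.
- by rewrite unfold_in /param_kernel /param_subst rmorph1 oner_eq0.
- move=> f g h; rewrite !unfold_in /param_kernel /param_subst => /eqP eg /eqP eh.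
  by rewrite /param_kernel /param_subst rmorphD rmorphM /= eg eh mulr0 addr0.
Qed.

Lemma param_kernel_prime : prime_idealr_closed param_kernel.
Proof.
by move=> f g; rewrite !unfold_in /param_kernel /param_subst rmorphM mulf_eq0.
Qed.

HB.instance Definition _ := isIdealr.Build _ param_kernel param_kernel_ideal.
HB.instance Definition _ := isPrimeIdealrClosed.Build _ param_kernel param_kernel_prime.

Definition generic_point : Aspec k n := param_kernel.

End Kernel.

Section Residue.
Variable P : Aspec k n.

Definition residue (f : {mpoly k[n]}) : residue_field P :=
  tofrac (\pi_({ideal_quot (P : prime_idealr _)})%qT f : quot_dom P).

Lemma residue_zmod : zmod_morphism residue.
Proof.
move=> f g; rewrite /residue -tofracB; congr tofrac.
exact: (rmorphB (\pi_({ideal_quot (P : prime_idealr _)})%qT)).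
Qed.

Lemma residue_monoid : monoid_morphism residue.
Proof.
split=> [|f g]; rewrite /residue.
  rewrite -tofrac1; congr tofrac.
  exact: (rmorph1 (\pi_({ideal_quot (P : prime_idealr _)})%qT)).
rewrite -tofracM; congr tofrac.
exact: (rmorphM (\pi_({ideal_quot (P : prime_idealr _)})%qT)).
Qed.

HB.instance Definition _ := GRing.isZmodMorphism.Build _ _ residue residue_zmod.
HB.instance Definition _ := GRing.isMonoidMorphism.Build _ _ residue residue_monoid.

Definition residue_scalar : {rmorphism k -> residue_field P} := residue \o @mpolyC n k.

Lemma residue_coords f : mmap residue_scalar (@coords k n P) f = residue f.
Proof.
elim/mpoly_ind_gen: f => [c|i|f g ef eg|f g ef eg].
- by rewrite mmapC.
- by rewrite mmapX mmap1U.
- by rewrite !rmorphD /= ef eg.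
- by rewrite !rmorphM /= ef eg.
Qed.

Lemma residue_eq0 f : residue f = 0 <-> f \in (P : prime_idealr _).
Proof.
rewrite -[f in f \in _]subr0 Quotient.idealrBE.
have e0 : \pi_({ideal_quot (P : prime_idealr _)})%qT 0 = 0 :> {ideal_quot (P : prime_idealr _)}.
  exact: (rmorph0 (\pi_({ideal_quot (P : prime_idealr _)})%qT)).
split=> [/eqP|/eqP e]; rewrite /residue.
  rewrite tofrac_eq0 => /eqP e; apply/eqP; rewrite e0; exact: e.
apply/eqP; rewrite tofrac_eq0; apply/eqP; rewrite -[RHS]e0; exact: e.
Qed.

End Residue.

Lemma spec_closedP (F : Aspec k n -> Prop) : spec_closed F <->
  exists J : {mpoly k[n]} -> Prop, forall P, F P <->
    forall f, J f -> vanish residue_scalar (@coords k n) f P.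
Proof.
by split=> -[J hJ]; exists J => P; rewrite hJ; split=> h f /h;
  rewrite /vanish residue_coords residue_eq0.
Qed.

(** The kernel of the parametrization is a point of the spectrum. *)
Lemma spec_dense N (theta : 'I_n -> {mpoly k[N]}) f : param_subst theta f != 0 ->
  exists2 P, param_image residue_scalar (@coords k n) theta P &
             ~ vanish residue_scalar (@coords k n) f P.
Proof.
move=> nf; exists (generic_point theta).
  move=> g g0; rewrite /vanish residue_coords residue_eq0 unfold_in /=.
  by rewrite /param_kernel g0.
rewrite /vanish residue_coords residue_eq0 unfold_in /= /param_kernel.
exact/negP.
Qed.

End SpecPoints.

(** * The points of k^n *)

Section AffinePoints.
Variables (k : fieldType) (n : nat).

Definition affine_scalar (p : 'I_n -> k) : {rmorphism k -> k} := idfun.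
Definition affine_coords (p : 'I_n -> k) : 'I_n -> k := p.

Lemma zariski_closedP (F : ('I_n -> k) -> Prop) : zariski_closed F <->
  exists J : {mpoly k[n]} -> Prop, forall p, F p <->
    forall f, J f -> vanish affine_scalar affine_coords f p.
Proof. by []. Qed.

Lemma affine_dense N (theta : 'I_n -> {mpoly k[N]}) f : infinite_field k ->
  param_subst theta f != 0 ->
  exists2 p, param_image affine_scalar affine_coords theta p &
             ~ vanish affine_scalar affine_coords f p.
Proof.
move=> inf /(infinite_nonvanishing inf) [v hv].
have E g : g.@[fun s => (theta s).@[v]] = (param_subst theta g).@[v].
  elim/mpoly_ind_gen: g => [c|i|g h eg eh|g h eg eh].
  - by rewrite /param_subst mmapC !mevalC.
  - by rewrite /param_subst mmapX mmap1U mevalXU.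
  - by rewrite mevalD eg eh /param_subst rmorphD /= mevalD.
  - by rewrite mevalM eg eh /param_subst rmorphM /= mevalM.
exists (fun s => (theta s).@[v]) => [g g0|]; rewrite /vanish.
  by rewrite [LHS]E g0 meval0.
by move=> e; move: hv; rewrite -E [X in X != 0]e eqxx.
Qed.

End AffinePoints.

(** * The Betti strata of V(L) *)

Section Strata.
Variables (k : fieldType) (L : {mpoly k[2]} -> Prop) (j u : int).
Hypothesis L_rad : forall f, radical L f <-> ideal_xy f.
Hypothesis L_lex : lex_segment_ideal L.

Local Notation b0 := (#|wE L j|%:Z).
Local Notation b1 := (#|vE L j|%:Z).
Local Notation sigma := (block_coord L_rad L_lex (j := j)).

Lemma V_geE (K : fieldType) (p : 'I_(nE L) -> K) :
  V_ge j u p <-> (\rank (point_mx sigma p))%:Z <= b0 - u.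
Proof.
rewrite /V_ge (betti0_block L_rad L_lex) -/(point_mx sigma p).
have := rank_leq_row (point_mx sigma p); set r := \rank _ => hr.
by split=> [[_]|h]; [|split; first exact: Ip_in_V]; lia.
Qed.

Lemma V_eqE (K : fieldType) (p : 'I_(nE L) -> K) :
  V_eq j u p <-> (\rank (point_mx sigma p))%:Z = b0 - u.
Proof.
rewrite /V_eq (betti0_block L_rad L_lex) -/(point_mx sigma p).
have := rank_leq_row (point_mx sigma p); set r := \rank _ => hr.
by split=> [[_]|h]; [|split; first exact: Ip_in_V]; lia.
Qed.

Section System.
Variables (X : Type) (closed : (X -> Prop) -> Prop).
Variables (Kp : X -> fieldType) (iota : forall x, {rmorphism k -> Kp x})
  (pt : forall x, 'I_(nE L) -> Kp x).
Hypothesis closedP : forall F, closed F <->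
  exists J : {mpoly k[nE L]} -> Prop, forall x, F x <-> forall f, J f -> vanish iota pt f x.
Hypothesis dense : forall N (theta : 'I_(nE L) -> {mpoly k[N]}) f, param_subst theta f != 0 ->
  exists2 x, param_image iota pt theta x & ~ vanish iota pt f x.

(** Parts (1) and (2) for any system of points: V(L,j,>=u) is the locus where the
    matrix of distinct coordinates has rank at most r = b0 - u. *)
Theorem determinantal_strata :
  let Vge := fun x => V_ge j u (pt x) in
  let Veq := fun x => V_eq j u (pt x) in
  [/\ u <= b0 -> irreducible closed Vge,
      (exists x, Veq x) <-> [/\ 0 <= u, b0 - b1 <= u & u <= b0],
      (exists x, Veq x) -> forall x, Vge x <-> top_closure closed Veq x
    & 0 <= u -> b0 - b1 <= u <= b0 ->
        exists2 n : nat, n%:Z = (b1 - b0 + u) * u & has_codim closed Vge n].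
Proof.
move=> Vge Veq; have sinj := @block_coord_inj _ _ L_rad L_lex j.
have VgeE r x : r%:Z = b0 - u -> rank_le sigma pt r x <-> Vge x.
  by move=> er; rewrite /Vge V_geE -er lez_nat.
have VeqE r x : r%:Z = b0 - u -> rank_eq sigma pt r x <-> Veq x.
  by move=> er; rewrite /Veq V_eqE -er; split=> [->|[]].
have rE : u <= b0 -> exists r : nat, r%:Z = b0 - u.
  by move=> h; exists `|b0 - u|%N; lia.
have nonempty : (exists x, Veq x) <-> [/\ 0 <= u, b0 - b1 <= u & u <= b0].
  split=> [[x hx]|[u0 u1 u2]].
    have := hx; rewrite /Veq V_eqE.
    have := rank_leq_row (point_mx sigma (pt x)); have := rank_leq_col (point_mx sigma (pt x)).
    by case: hx => _ <-; move: (\rank _) => r; split; lia.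
  have [r er] := rE u2; have [|x hx] := proj2 (exists_rank_eq sinj dense r).
    by apply/andP; split; lia.
  by exists x; apply/(VeqE r).
split=> //.
- move=> /rE [r er]; apply: irreducible_ext (irreducible_rank_le sinj closedP dense r) => x.
  exact: VgeE.
- move=> /nonempty [u0 u1 u2] x; have [r er] := rE u2.
  have rm : (r <= #|wE L j|)%N by lia.
  have rq : (r <= #|vE L j|)%N by lia.
  rewrite -(VgeE r) // (rank_le_closure sinj closedP dense x rm rq).
  by split=> h F cF incF; apply: h => // y hy; apply: incF; apply/(VeqE r).
- move=> u0 /andP [u1 u2]; have [r er] := rE u2.
  have rm : (r <= #|wE L j|)%N by lia.
  have rq : (r <= #|vE L j|)%N by lia.
  exists ((#|wE L j| - r) * (#|vE L j| - r))%N.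
    by rewrite PoszM -!subzn // mulrC er; congr (_ * _); lia.
  have chE l : irr_chain closed Vge l <-> irr_chain closed (rank_le sigma pt r) l.
    by split=> -[F [F0 Fi Fs]]; exists F; split=> // x; rewrite F0 (VgeE r).
  have [c1 c2] := rank_le_codim sinj closedP dense rm rq.
  by split=> [|l]; rewrite chE // => /c2.
Qed.

End System.

End Strata.

Theorem corollary4p6 (k : fieldType) (L : {mpoly k[2]} -> Prop) (j u : int)
  (L_lex : lex_segment_ideal L)
  (L_rad : forall f, radical L f <-> ideal_xy f) :
  let b0 : int := (betti L 0 j)%:Z in
  let b1 : int := (betti L 1 j)%:Z in
  let c : int := (b1 - b0 + u) * u in
  [/\
    (* M(p)_j is a matrix of distinct variables of size b0 x b1 *)
    [/\ #|wE L j|%:Z = b0, #|vE L j|%:Z = b1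
      & exists2 sigma : 'I_#|wE L j| * 'I_#|vE L j| -> 'I_(nE L),
          injective sigma
        & forall (K : fieldType) (p : 'I_(nE L) -> K),
            Mpj p j = \matrix_(a, b) (p (sigma (a, b)))%:MP],
    (* the equations of V(L,j,>=u), on k-rational points and on all points *)
    (forall p : 'I_(nE L) -> k,
        V_ge j u p <-> (rank_dom (Mpj p j))%:Z <= b0 - u) /\
    (forall P : prime_idealr {mpoly k[nE L]},
        V_ge j u (coords P) <-> (rank_dom (Mpj (coords P) j))%:Z <= b0 - u),
    (* (1) and (2), for the scheme A^n over an arbitrary field *)
    let Vge := fun P : Aspec k (nE L) => V_ge j u (coords P) in
    let Veq := fun P : Aspec k (nE L) => V_eq j u (coords P) in
    [/\ u <= b0 -> irreducible (@spec_closed k (nE L)) Vge,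
        (exists P, Veq P) <-> [/\ 0 <= u, b0 - b1 <= u & u <= b0],
        (exists P, Veq P) ->
          forall P, Vge P <-> top_closure (@spec_closed k (nE L)) Veq P
      & 0 <= u -> b0 - b1 <= u <= b0 ->
          exists2 n : nat, n%:Z = c & has_codim (@spec_closed k (nE L)) Vge n]
  & (* (1) and (2), for k^n with its Zariski topology *)
    infinite_field k ->
    let Vge := fun p : 'I_(nE L) -> k => V_ge j u p in
    let Veq := fun p : 'I_(nE L) -> k => V_eq j u p in
    [/\ u <= b0 -> irreducible (@zariski_closed k (nE L)) Vge,
        (exists p, Veq p) <-> [/\ 0 <= u, b0 - b1 <= u & u <= b0],
        (exists p, Veq p) ->
          forall p, Vge p <-> top_closure (@zariski_closed k (nE L)) Veq p
      & 0 <= u -> b0 - b1 <= u <= b0 ->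
          exists2 n : nat, n%:Z = c & has_codim (@zariski_closed k (nE L)) Vge n]].
Proof.
rewrite (betti0_L L_rad L_lex) (betti1_L L_rad L_lex); split.
- split=> //; exists (block_coord L_rad L_lex (j := j)); first exact: block_coord_inj.
  by move=> K p; apply: MpjE.
- by split=> p; rewrite (rank_Mpj L_rad L_lex); apply: V_geE.
- exact: (@determinantal_strata k L j u L_rad L_lex _ _ (@residue_field k _) (@residue_scalar k _)
    (@coords k _) (@spec_closedP k _) (@spec_dense k _)).
- move=> inf; exact: (@determinantal_strata k L j u L_rad L_lex _ _ (fun _ => k) (@affine_scalar k _)
    (@affine_coords k _) (@zariski_closedP k _) (fun N theta f => affine_dense inf)).
Qed.
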